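(* (Block complex step approximation, second order Fréchet derivative.) Let $A_0,E_1,E_2$ be complex $n\times n$ matrices and let $f$ be analytic on an open set $\Omega\subseteq\mathbb{C}$ containing the spectrum of $A_0$ and such that $f(A)$ is real-valued for real matrices $A$. For real $h\neq 0$ let $$X_2=\begin{bmatrix}A_0 & hE_1 & hE_2 & 0\\ -hE_1 & A_0 & 0 & hE_2\\ -hE_2 & 0 & A_0 & hE_1\\ 0 & -hE_2 & -hE_1 & A_0\end{bmatrix}.$$ Then, as $h\to 0$, $$L_f^{(2)}(A_0,E_1,E_2)=\frac{1}{h^2}\,[f(X_2)]_{1,4}+O(h^2),$$ where $[\cdot]_{1,4}$ denotes the upper right $n\times n$ block.
   Context: $f(A)$ denotes the matrix function in the standard sense (for square matrices of any size with spectrum in $\Omega$). ''Real-valued for real matrices'' means: $f(A)$ is real for every real square matrix $A$ with spectrum in $\Omega$. $L_f(A,E)$ is the Fréchet derivative: the unique mapping, linear in $E$, with $L_f(A,E)=f(A+E)-f(A)+o(\|E\|)$. $L_f^{(2)}(A,E_1,E_2)$ is the second order Fréchet derivative: the mapping, linear in each of $E_1,E_2$, with $L_f^{(2)}(A,E_1,E_2)=L_f(A+E_2,E_1)-L_f(A,E_1)+o(\|E_2\|)$. *)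

(* Defs.v *)
From HB Require Import structures.
From mathcomp Require Import all_boot all_order all_algebra.
From mathcomp Require Import all_classical all_reals all_analysis.
From mathcomp Require Import complex.

Set Implicit Arguments.
Unset Strict Implicit.
Unset Printing Implicit Defensive.

Import Order.TTheory GRing.Theory Num.Theory.
Import numFieldNormedType.Exports.

Local Open Scope classical_set_scope.
Local Open Scope ring_scope.
Local Open Scope complex_scope.

(* R[i] with the topology of its modulus, as a normed space over itself, so   *)
(* that derivatives of functions on R[i] and on 'M[R[i]]_n are complex ones.  *)
HB.instance Definition _ (R : rcfType) := PseudoPointedMetric.copy R[i] R[i]^o.
HB.instance Definition _ (R : rcfType) := GRing.ComAlgebra.copy R[i] R[i]^o.
HB.instance Definition _ (R : rcfType) := Vector.copy R[i] R[i]^o.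
HB.instance Definition _ (R : rcfType) := NormedModule.copy R[i] R[i]^o.

Section MatrixFunction.
Variable R : realType.
Local Notation C := R[i].
Implicit Type f : C -> C.

Definition analytic_on (Omega : set C) f : Prop :=
  forall z0, Omega z0 -> exists a : nat -> C,
    \forall z \near z0,
      series (fun k => a k * (z - z0) ^+ k) @ \oo --> f z.

Definition spectrum_in (Omega : set C) n (A : 'M[C]_n) : Prop :=
  forall z, eigenvalue A z -> Omega z.

(* p is the Hermite interpolation polynomial of f on the spectrum of A: its   *)
(* degree is less than that of the minimal polynomial of A, and at each root  *)
(* of the latter p matches the derivatives of f of order less than the        *)
(* multiplicity of the root.                                                  *)
Definition hermite_interpolant f n (A : 'M[C]_n.+1) (p : {poly C}) : Prop :=
  (size p <= degree_mxminpoly A)%N /\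
  forall z j, (j < mup z (mxminpoly A))%N -> (derivn j p).[z] = derive1n j f z.

(* The primary matrix function f(A) = p(A).  The interpolant p exists and is  *)
(* unique, so the default value 0 is never used.                              *)
Definition mxfun f n (A : 'M[C]_n.+1) : 'M[C]_n.+1 :=
  horner_mx A (xget 0 [set p | hermite_interpolant f A p]).

Definition real_for_real (Omega : set C) f : Prop :=
  forall m (A : 'M[C]_m.+1),
    A \is a mxOver Num.real -> spectrum_in Omega A ->
    mxfun f A \is a mxOver Num.real.

(* Total operators: the values are meaningful only at points of               *)
(* differentiability, which statements must assert separately.                *)
Definition frechet f n (A E : 'M[C]_n.+1) : 'M[C]_n.+1 :=
  'd (@mxfun f n) A E.

Definition frechet2 f n (A E1 E2 : 'M[C]_n.+1) : 'M[C]_n.+1 :=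
  'd (fun B => frechet f B E1) A E2.

Definition X2 n (A0 E1 E2 : 'M[C]_n.+1) (h : R) :
    'M[C]_((n.+1 + n.+1) + (n.+1 + n.+1)) :=
  let hE1 := h%:C *: E1 in
  let hE2 := h%:C *: E2 in
  block_mx (block_mx A0 hE1 (- hE1) A0)      (block_mx hE2 0 0 hE2)
           (block_mx (- hE2) 0 0 (- hE2))    (block_mx A0 hE1 (- hE1) A0).

Definition block14 n (M : 'M[C]_((n.+1 + n.+1) + (n.+1 + n.+1))) : 'M[C]_n.+1 :=
  ursubmx (ursubmx M).

End MatrixFunction.

(* Main.v *)
Require Import Defs.
From HB Require Import structures.
From mathcomp Require Import all_boot all_order all_algebra.
From mathcomp Require Import all_classical all_reals all_analysis.
From mathcomp Require Import complex.
From mathcomp Require Import ring lra.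
Import Order.TTheory GRing.Theory Num.Theory.
Import numFieldNormedType.Exports.
Import ComplexField.
Set Implicit Arguments.
Unset Strict Implicit.
Unset Printing Implicit Defensive.
Local Open Scope classical_set_scope.
Local Open Scope ring_scope.

(** Everything is reduced to polynomials.  Given finitely many matrices near A0,
    interpolate f at all their eigenvalues, with multiplicities: the resulting
    polynomial p satisfies f(B) = p(B) for every B, of any size, annihilated by
    the product of the characteristic polynomials of the given matrices.  The
    degree of p is bounded by the number of nodes, and its coefficients are
    bounded uniformly.  For nodes in one disc of convergence this follows from
    Newton's scheme, where each step replaces the power series of f by that of a
    difference quotient; nodes in different discs are joined by Neville's scheme,
    whose denominators are bounded below by the distance between the discs.

    A Taylor estimate for p around A0 is then an estimate for f, with constants
    that do not depend on p.  The Taylor coefficients themselves do not depend on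
    p either, because they are blocks of f at block triangular matrices such as
    [A E; 0 A].  This gives both differentiability claims.

    Finally X2 is the Kronecker combination of A0, hE1 and hE2 with the rotation
    [0 1; -1 0], whose eigenvalues are +i and -i.  Diagonalizing both rotations gives
      -4 [f(X2)]_{1,4} = f(A0 + w(E1+E2)) + f(A0 - w(E1+E2))
                         - f(A0 + w(E1-E2)) - f(A0 - w(E1-E2)),   w = ih,
    where all odd powers of w cancel and the term in w^2 is 4 w^2 times the second
    derivative. *)

(** * Matrix norms and polynomial sums *)

Section EntrySumNorm.
Variable K : numDomainType.

(** The entrywise sum is submultiplicative for all rectangular shapes, which the entrywise maximum
    is not. The two norms are compared only when differentials and the final big-O are reached. *)
Definition mnorm m n (A : 'M[K]_(m, n)) : K := \sum_i \sum_j `|A i j|.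

Lemma mnorm_ge0 m n (A : 'M[K]_(m, n)) : 0 <= mnorm A.
Proof. by apply: sumr_ge0 => i _; apply: sumr_ge0. Qed.

Lemma mnorm0 m n : mnorm (0 : 'M[K]_(m, n)) = 0.
Proof.
by rewrite /mnorm big1 // => i _; rewrite big1 // => j _; rewrite mxE normr0.
Qed.

Lemma mnormD m n (A B : 'M[K]_(m, n)) : mnorm (A + B) <= mnorm A + mnorm B.
Proof.
rewrite /mnorm -big_split /=; apply: ler_sum => i _.
by rewrite -big_split /=; apply: ler_sum => j _; rewrite mxE ler_normD.
Qed.

Lemma mnormZ m n (c : K) (A : 'M[K]_(m, n)) : mnorm (c *: A) = `|c| * mnorm A.
Proof.
rewrite /mnorm mulr_sumr; apply: eq_bigr => i _.
by rewrite mulr_sumr; apply: eq_bigr => j _; rewrite mxE normrM.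
Qed.

Lemma mnormN m n (A : 'M[K]_(m, n)) : mnorm (- A) = mnorm A.
Proof. by rewrite -scaleN1r mnormZ normrN1 mul1r. Qed.

Lemma entry_le_mnorm m n (A : 'M[K]_(m, n)) i j : `|A i j| <= mnorm A.
Proof.
rewrite /mnorm (bigD1 i) //= (bigD1 j) //= -addrA lerDl addr_ge0 //.
  exact: sumr_ge0.
by apply: sumr_ge0 => k _; apply: sumr_ge0.
Qed.

Lemma mnorm_mulmx m n p (A : 'M[K]_(m, n)) (B : 'M[K]_(n, p)) :
  mnorm (A *m B) <= mnorm A * mnorm B.
Proof.
rewrite {1}/mnorm [X in _ <= X * _]/mnorm mulr_suml; apply: ler_sum => i _.
apply: (@le_trans _ _ (\sum_k \sum_j `|A i j| * `|B j k|)).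
  apply: ler_sum => k _; rewrite mxE.
  by apply: le_trans (ler_norm_sum _ _ _) _; apply: ler_sum => j _; rewrite normrM.
rewrite exchange_big mulr_suml; apply: ler_sum => j _ /=.
rewrite -mulr_sumr ler_wpM2l // /mnorm (bigD1 j) //= lerDl.
by apply: sumr_ge0 => k _; apply: sumr_ge0.
Qed.

Lemma mnorm_sum m n (I : Type) (r : seq I) (P : pred I) (F : I -> 'M[K]_(m, n)) :
  mnorm (\sum_(i <- r | P i) F i) <= \sum_(i <- r | P i) mnorm (F i).
Proof.
elim/big_rec2: _ => [|i x y _ le_xy]; first by rewrite mnorm0.
by apply: le_trans (mnormD _ _) _; rewrite lerD2l.
Qed.

End EntrySumNorm.

(** * Polynomial combinations of a sequence *)

Section PolynomialSums.
Variable K : comNzRingType.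

(** The powers of X in p are replaced by the terms of [G]: matrix powers, their derivatives, or
    Taylor remainders. Linearity reduces every estimate for p to one estimate per power. *)
Definition psum (V : lmodType K) (p : {poly K}) (G : nat -> V) : V :=
  \sum_(i < size p) p`_i *: G i.

Lemma psum_widen (V : lmodType K) (p : {poly K}) (G : nat -> V) m :
  (size p <= m)%N -> psum p G = \sum_(i < m) p`_i *: G i.
Proof.
move=> le_pm; rewrite /psum (big_ord_widen m (fun i => p`_i *: G i)) //.
rewrite big_mkcond; apply: eq_bigr => i _; case: ltnP => // le_pi.
by rewrite nth_default // scale0r.
Qed.

Lemma psum_add (V : lmodType K) p (G H : nat -> V) c :
  psum p (fun i => c *: G i + H i) = c *: psum p G + psum p H.
Proof.
rewrite scaler_sumr -big_split; apply: eq_bigr => i _ /=.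
by rewrite scalerDr !scalerA mulrC.
Qed.

Lemma psum_sub (V : lmodType K) p (G H : nat -> V) :
  psum p (fun i => G i - H i) = psum p G - psum p H.
Proof. by rewrite -sumrB; apply: eq_bigr => i _; rewrite scalerBr. Qed.

Lemma eq_psum (V : lmodType K) p (G H : nat -> V) :
  G =1 H -> psum p G = psum p H.
Proof. by move=> GH; apply: eq_bigr => i _; rewrite GH. Qed.

Lemma horner_mx_psum n (A : 'M[K]_n.+1) p :
  horner_mx A p = psum p (fun i => A ^+ i).
Proof.
rewrite -{1}[p]coefK poly_def rmorph_sum; apply: eq_bigr => i _.
by rewrite /= horner_mxZ rmorphXn /= horner_mx_X.
Qed.

End PolynomialSums.

(* Identities of noncommutative matrix polynomials hold entrywise by [ring] once
   they are expanded and every product is treated as an atom. *)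
Ltac mx_abelian :=
  repeat match goal with |- context [@mulmx ?T ?a ?b ?c ?X ?Y] =>
    let x := fresh in set x := (@mulmx _ _ _ _ X Y); clearbody x end;
  apply/matrixP => ? ?; rewrite !mxE; ring.

(** * Formal derivatives of matrix powers and matrix polynomials *)

Section PowerDerivatives.
Variable K : comNzRingType.
Variable n : nat.
Implicit Types A E F : 'M[K]_n.+1.

(** This recursion and the next are the product rule for A^(k+1) = A^k A, applied once in direction
    E and then again in direction F; no limit is involved. *)
Fixpoint dpow k A E : 'M[K]_n.+1 :=
  if k is k'.+1 then dpow k' A E *m A + A ^+ k' *m E else 0.

Fixpoint d2pow k A E F : 'M[K]_n.+1 :=
  if k is k'.+1
  then d2pow k' A E F *m A + dpow k' A E *m F + dpow k' A F *m E else 0.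

Lemma dpowS k A E : dpow k.+1 A E = dpow k A E * A + A ^+ k * E.
Proof. by []. Qed.

Lemma dpow_is_linear k A : linear (dpow k A).
Proof.
elim: k => [|k IHk] c E F /=; first by rewrite scaler0 addr0.
rewrite IHk mulmxDl mulmxDr scalerDr -scalemxAl -scalemxAr.
mx_abelian.
Qed.
HB.instance Definition _ k A :=
  GRing.isLinear.Build K _ _ _ (dpow k A) (dpow_is_linear k A).

Lemma d2pow_is_linear k A E : linear (d2pow k A E).
Proof.
elim: k => [|k IHk] c F G /=; first by rewrite scaler0 addr0.
rewrite IHk (linearP (dpow k A)) /= !mulmxDl mulmxDr !scalerDr -!scalemxAl -!scalemxAr.
mx_abelian.
Qed.
HB.instance Definition _ k A E :=
  GRing.isLinear.Build K _ _ _ (d2pow k A E) (d2pow_is_linear k A E).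

Definition dpoly p A E := psum p (fun k => dpow k A E).
Definition d2poly p A E F := psum p (fun k => d2pow k A E F).

Lemma dpoly_is_linear p A : linear (dpoly p A).
Proof.
move=> c E F; rewrite -psum_add; apply: eq_psum => k.
exact: (linearP (dpow k A)).
Qed.
HB.instance Definition _ p A :=
  GRing.isLinear.Build K _ _ _ (dpoly p A) (dpoly_is_linear p A).

Lemma d2poly_is_linear p A E : linear (d2poly p A E).
Proof.
move=> c F G; rewrite -psum_add; apply: eq_psum => k.
exact: (linearP (d2pow k A E)).
Qed.
HB.instance Definition _ p A E :=
  GRing.isLinear.Build K _ _ _ (d2poly p A E) (d2poly_is_linear p A E).

End PowerDerivatives.

(** * Derivatives as blocks of block triangular matrices *)

Section TriangularBlocks.
Variables (K : comNzRingType) (n : nat).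
Implicit Types A E F : 'M[K]_n.+1.

Lemma mul_block (A B C D A' B' C' D' : 'M[K]_n.+1) :
  (block_mx A B C D : 'M[K]_(n.+1 + n.+1)) * block_mx A' B' C' D' =
  block_mx (A *m A' + B *m C') (A *m B' + B *m D')
           (C *m A' + D *m C') (C *m B' + D *m D').
Proof. exact: mulmx_block. Qed.

Lemma scale_add_block c (A B C D A' B' C' D' : 'M[K]_n.+1) :
  c *: (block_mx A B C D : 'M[K]_(n.+1 + n.+1)) + block_mx A' B' C' D' =
  block_mx (c *: A + A') (c *: B + B') (c *: C + C') (c *: D + D').
Proof. by rewrite scale_block_mx add_block_mx. Qed.

(** The matrix [A E; 0 A] stands for A + eps E with eps^2 = 0, so the eps part of its powers is the
    derivative in direction E. *)
Lemma expr_block_tri A E k :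
  (block_mx A E 0 A : 'M[K]_(n.+1 + n.+1)) ^+ k =
  block_mx (A ^+ k) (dpow k A E) 0 (A ^+ k).
Proof.
elim: k => [|k IHk]; first by rewrite !expr0 -scalar_mx_block.
rewrite exprSr IHk mul_block !(mulmx0, mul0mx, addr0, add0r) /=.
by rewrite !mulmxE -!exprSr addrC.
Qed.

(** Differentiating the previous identity once more, along F in both diagonal blocks, turns the
    off-diagonal first derivative into the second one. *)
Lemma dpow_block_tri A E F k :
  dpow k (block_mx A E 0 A : 'M[K]_(n.+1 + n.+1)) (block_mx F 0 0 F) =
  block_mx (dpow k A F) (d2pow k A E F) 0 (dpow k A F).
Proof.
elim: k => [|k IHk]; first by rewrite /= block_mx0.
rewrite dpowS IHk expr_block_tri !mul_block.
rewrite !(mulmx0, mul0mx, addr0, add0r).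
rewrite [LHS](add_block_mx (dpow k A F *m A)) addr0.
by rewrite /= [dpow k A F *m E + _]addrC addrAC.
Qed.

Lemma horner_block_tri A E p :
  horner_mx (block_mx A E 0 A : 'M[K]_(n.+1 + n.+1)) p =
  block_mx (horner_mx A p) (dpoly p A E) 0 (horner_mx A p).
Proof.
rewrite !horner_mx_psum /dpoly /psum.
elim/big_rec3: _ => [|i x y z _ ->]; first by rewrite block_mx0.
by rewrite expr_block_tri [LHS]scale_add_block scaler0 addr0.
Qed.

Lemma dpoly_block_tri A E F p :
  dpoly p (block_mx A E 0 A : 'M[K]_(n.+1 + n.+1)) (block_mx F 0 0 F) =
  block_mx (dpoly p A F) (d2poly p A E F) 0 (dpoly p A F).
Proof.
rewrite /d2poly /dpoly /psum.
elim/big_rec3: _ => [|i x y z _ ->]; first by rewrite block_mx0.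
by rewrite dpow_block_tri [LHS]scale_add_block scaler0 addr0.
Qed.

(** If q kills A, then q at the block matrix has only its upper right block left, and such a matrix
    squares to zero. This tells how many copies of a characteristic polynomial annihilate a block
    triangular matrix. *)
Lemma horner_block_tri_sqr_eq0 A E q : horner_mx A q = 0 ->
  horner_mx (block_mx A E 0 A : 'M[K]_(n.+1 + n.+1)) (q * q) = 0.
Proof.
move=> qA0; rewrite rmorphM /= horner_block_tri qA0 mul_block.
by rewrite !(mulmx0, mul0mx, addr0, add0r) block_mx0.
Qed.

End TriangularBlocks.

(** * Taylor remainders of matrix powers *)

Section Estimates.
Variables (K : numFieldType) (n : nat).
Implicit Types A B E F : 'M[K]_n.+1.

(** An O(w) estimate with one constant on the whole of [Q] instead of along a filter, so that
    constants can be added and multiplied through inductions on the exponent. *)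
Definition bounded_by (T : Type) (Q : T -> Prop) (w : T -> K)
    (F : T -> 'M[K]_n.+1) : Prop :=
  exists2 c, 0 <= c & forall t, Q t -> mnorm (F t) <= c * w t.

Section BoundedBy.
Variables (T : Type) (Q : T -> Prop).
Implicit Types (w : T -> K) (G H : T -> 'M[K]_n.+1).

Lemma bounded_by0 w : bounded_by Q w (fun => 0).
Proof. by exists 0 => // t _; rewrite mnorm0 mul0r. Qed.

Lemma bounded_byD w G H : bounded_by Q w G -> bounded_by Q w H ->
  bounded_by Q w (fun t => G t + H t).
Proof.
move=> [c c0 Gc] [d d0 Hd]; exists (c + d); first exact: addr_ge0.
move=> t Qt; rewrite mulrDl; apply: le_trans (mnormD _ _) _.
by apply: lerD; [apply: Gc | apply: Hd].
Qed.

Lemma bounded_byM w v G H :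
  bounded_by Q w G -> bounded_by Q v H ->
  bounded_by Q (fun t => w t * v t) (fun t => G t *m H t).
Proof.
move=> [c c0 Gc] [d d0 Hd]; exists (c * d); first exact: mulr_ge0.
move=> t Qt; rewrite mulrACA; apply: le_trans (mnorm_mulmx _ _) _.
by apply: ler_pM; rewrite ?mnorm_ge0 ?Gc ?Hd.
Qed.

Lemma bounded_byZ w (c : K) G : bounded_by Q w G ->
  bounded_by Q w (fun t => c *: G t).
Proof.
move=> [d d0 Gd]; exists (`|c| * d); first exact: mulr_ge0.
by move=> t Qt; rewrite mnormZ -mulrA ler_wpM2l ?Gd.
Qed.

Lemma bounded_byMl w G A : bounded_by Q w G -> bounded_by Q w (fun t => A *m G t).
Proof.
move=> [d d0 Gd]; exists (mnorm A * d); first by rewrite mulr_ge0 ?mnorm_ge0.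
move=> t Qt; rewrite -mulrA; apply: le_trans (mnorm_mulmx _ _) _.
by rewrite ler_wpM2l ?mnorm_ge0 ?Gd.
Qed.

Lemma bounded_byMr w G A : bounded_by Q w G -> bounded_by Q w (fun t => G t *m A).
Proof.
move=> [d d0 Gd]; exists (d * mnorm A); first by rewrite mulr_ge0 ?mnorm_ge0.
move=> t Qt; rewrite mulrAC; apply: le_trans (mnorm_mulmx _ _) _.
by rewrite ler_wpM2r ?mnorm_ge0 ?Gd.
Qed.

Lemma bounded_by_cst w A : (forall t, Q t -> 1 <= w t) ->
  bounded_by Q w (fun => A).
Proof.
move=> w1; exists (mnorm A); first exact: mnorm_ge0.
by move=> t Qt; rewrite ler_peMr ?mnorm_ge0 ?w1.
Qed.

Lemma eq_bounded_by w v G H : (forall t, Q t -> w t = v t) ->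
  (forall t, Q t -> G t = H t) -> bounded_by Q w G -> bounded_by Q v H.
Proof.
move=> wv GH [c c0 Gc]; exists c => // t Qt.
by rewrite -GH // -wv // Gc.
Qed.

(** The constant is chosen before p and depends only on the degree bound m and the coefficient bound
    M. This is what makes the Taylor estimates independent of the interpolating polynomial. *)
Lemma psum_bounded_by w (G : nat -> T -> 'M[K]_n.+1) m (M : K) : 0 <= M ->
  (forall t, 0 <= w t) -> (forall k, bounded_by Q w (G k)) ->
  exists2 c, 0 <= c & forall t (p : {poly K}), Q t ->
    (size p <= m)%N -> (forall i, `|p`_i| <= M) ->
    mnorm (psum p (fun k => G k t)) <= c * w t.
Proof.
move=> M0 w0 Gb; elim: m => [|m [c c0 IHm]].
  exists 0 => // t p _ le_p0 _.
  by rewrite (psum_widen _ le_p0) big_ord0 mnorm0 mul0r.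
have [d d0 Gd] := Gb m.
exists (c + M * d); first by rewrite addr_ge0 ?mulr_ge0.
move=> t p Qt le_pm pM; rewrite (psum_widen _ le_pm) big_ord_recr /= mulrDl.
apply: le_trans (mnormD _ _) _; apply: lerD; last first.
  by rewrite mnormZ -mulrA ler_pM ?mnorm_ge0 ?pM ?Gd.
pose q := \poly_(i < m) p`_i.
have szq : (size q <= m)%N by apply: size_poly.
rewrite [X in mnorm X](_ : _ = psum q (fun k => G k t)); last first.
  by rewrite (psum_widen _ szq); apply: eq_bigr => i _; rewrite coef_poly ltn_ord.
by apply: IHm => // i; rewrite coef_poly; case: ifP => // _; rewrite normr0.
Qed.

End BoundedBy.

(** The radius 1 is arbitrary; it only serves to bound B by 1 + |A| as a factor. *)
Definition near1 A B := mnorm (B - A) <= 1.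

Lemma bounded_by_sub A : bounded_by (near1 A) (fun B => mnorm (B - A)) (fun B => B - A).
Proof. by exists 1 => // B _; rewrite mul1r. Qed.

Lemma bounded_by_near1 A : bounded_by (near1 A) (fun=> 1) id.
Proof.
exists (1 + mnorm A); first by rewrite addr_ge0 ?mnorm_ge0.
move=> B AB; rewrite mulr1 -{1}[B](subrK A).
by apply: le_trans (mnormD _ _) _; rewrite lerD2r.
Qed.

Lemma bounded_byM_near1 A w G : bounded_by (near1 A) w G ->
  bounded_by (near1 A) w (fun B => G B *m B).
Proof.
move=> Gw; have := bounded_byM Gw (bounded_by_near1 A).
by apply: eq_bounded_by => // B _; rewrite mulr1.
Qed.

Lemma pow_rem0 A k :
  bounded_by (near1 A) (fun B => mnorm (B - A)) (fun B => B ^+ k - A ^+ k).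
Proof.
elim: k => [|k IHk].
  by apply: eq_bounded_by (bounded_by0 _ _) => // B _; rewrite !expr0 subrr.
have h1 := bounded_byM_near1 IHk.
have h2 := bounded_byMl (A ^+ k) (bounded_by_sub A).
apply: eq_bounded_by (bounded_byD h1 h2) => //.
move=> B _ /=; rewrite !exprSr -!mulmxE mulmxBl mulmxBr; mx_abelian.
Qed.

Lemma dpow_bound A k :
  bounded_by (near1 A) (fun B => mnorm (B - A)) (fun B => dpow k A (B - A)).
Proof.
elim: k => [|k IHk] /=; first exact: bounded_by0.
apply: bounded_byD; first exact: bounded_byMr.
exact/bounded_byMl/bounded_by_sub.
Qed.

Lemma d2pow_bound A E k :
  bounded_by (near1 A) (fun B => mnorm (B - A)) (fun B => d2pow k A E (B - A)).
Proof.
elim: k => [|k IHk] /=; first exact: bounded_by0.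
apply: bounded_byD; first apply: bounded_byD.
- exact: bounded_byMr.
- exact/bounded_byMl/bounded_by_sub.
- exact/bounded_byMr/dpow_bound.
Qed.

(** With D = B - A, the remainders satisfy R_(k+1) = R_k B + [dpow k A D] D, and both terms are
    quadratic in D. The neighbouring remainder lemmas use recursions of the same kind. *)
Lemma pow_rem1 A k : bounded_by (near1 A) (fun B => mnorm (B - A) ^+ 2)
  (fun B => B ^+ k - A ^+ k - dpow k A (B - A)).
Proof.
elim: k => [|k IHk].
  by apply: eq_bounded_by (bounded_by0 _ _) => // B _; rewrite !expr0 !subrr.
have h1 := bounded_byM_near1 IHk.
have h2 := bounded_byM (dpow_bound A k) (bounded_by_sub A).
apply: eq_bounded_by (bounded_byD h1 h2) => //.
move=> B _ /=; rewrite !exprSr -!mulmxE !mulmxBl !mulmxBr; mx_abelian.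
Qed.

Lemma dpow_rem1 A E k : bounded_by (near1 A) (fun B => mnorm (B - A) ^+ 2)
  (fun B => dpow k B E - dpow k A E - d2pow k A E (B - A)).
Proof.
elim: k => [|k IHk].
  by apply: eq_bounded_by (bounded_by0 _ _) => // B _; rewrite /= !subrr.
have h1 := bounded_byM_near1 IHk.
have h2 := bounded_byM (d2pow_bound A E k) (bounded_by_sub A).
have h3 := bounded_byMr E (pow_rem1 A k).
apply: eq_bounded_by (bounded_byD (bounded_byD h1 h2) h3) => //.
move=> B _ /=; rewrite !mulmxBl !mulmxBr; mx_abelian.
Qed.

(* [hpow j k A E] is the coefficient of [w ^+ j] in [(A + w *: E) ^+ k]. *)
Fixpoint hpow j k A E : 'M[K]_n.+1 :=
  if k is k'.+1 then
    hpow j k' A E *m A + (if j is j'.+1 then hpow j' k' A E *m E else 0)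
  else (j == 0%N)%:R%:M.

Lemma hpow0 k A E : hpow 0 k A E = A ^+ k.
Proof. by elim: k => [|k /= ->]; rewrite ?expr0 // addr0 exprSr. Qed.

Lemma hpowN j k A E : hpow j k A (- E) = (-1) ^+ j *: hpow j k A E.
Proof.
elim: k j => [|k IHk] [|j] /=; rewrite ?expr0 ?scale1r ?scaler0 ?raddf0 //.
  by rewrite !hpow0.
rewrite !IHk scalerDr -scalemxAl mulmxN -scalemxAl exprS mulN1r.
by rewrite -scaleNr.
Qed.

Lemma hpow1D k A E F c :
  hpow 1 k A (E + c *: F) = dpow k A E + c *: dpow k A F.
Proof.
elim: k => [|k IHk] /=; first by rewrite raddf0 scaler0 addr0.
rewrite IHk !hpow0 !mulmxDl mulmxDr !scalerDr -!scalemxAl -!scalemxAr; mx_abelian.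
Qed.

(** [hpow 2] is a quadratic form in the direction, with [d2pow] as its polar form. The cases c = 1
    and c = -1 isolate [d2pow] in the symmetric combination below. *)
Lemma hpow2D k A E F c : hpow 2 k A (E + c *: F) =
  hpow 2 k A E + c *: d2pow k A E F + c ^+ 2 *: hpow 2 k A F.
Proof.
elim: k => [|k IHk] /=; first by rewrite raddf0 !scaler0 !addr0.
have h1 G : hpow 1 k A G = dpow k A G.
  by have := hpow1D k A G 0 0; rewrite !scale0r !addr0.
rewrite IHk hpow1D !h1 !mulmxDl !mulmxDr !scalerDr -!scalemxAl -!scalemxAr.
by rewrite -?scalemxAl; mx_abelian.
Qed.

Lemma pow_rem3 A E k : bounded_by (fun w : K => `|w| <= 1) (fun w => `|w| ^+ 4)
  (fun w => (A + w *: E) ^+ k -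
    (A ^+ k + w *: hpow 1 k A E + w ^+ 2 *: hpow 2 k A E + w ^+ 3 *: hpow 3 k A E)).
Proof.
elim: k => [|k IHk].
  apply: eq_bounded_by (bounded_by0 _ _) => // w _ /=.
  by rewrite !expr0 raddf0 !scaler0 !addr0 subrr.
have hb : bounded_by (fun w : K => `|w| <= 1) (fun=> 1) (fun w => A + w *: E).
  apply: bounded_byD; first exact: bounded_by_cst.
  exists (mnorm E) => [|w w1]; first exact: mnorm_ge0.
  by rewrite mulr1 mnormZ ler_piMl ?mnorm_ge0.
have h1 := bounded_byM IHk hb.
have h2 : bounded_by (fun w : K => `|w| <= 1) (fun w => `|w| ^+ 4)
    (fun w => w ^+ 4 *: (hpow 3 k A E *m E)).
  exists (mnorm (hpow 3 k A E *m E)) => [|w w1]; first exact: mnorm_ge0.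
  by rewrite mnormZ normrX mulrC.
have h1w := eq_bounded_by (v := fun w => `|w| ^+ 4)
  (fun w _ => mulr1 _) (fun w _ => erefl) h1.
apply: eq_bounded_by (bounded_byD h1w h2) => // w _ /=.
rewrite ![_ ^+ k.+1]exprSr -!mulmxE.
rewrite hpow0 !mulmxBl !mulmxDl !mulmxDr !scalerDr -!scalemxAl -!scalemxAr.
by rewrite -?scalemxAl; mx_abelian.
Qed.

(** Pairing each direction with its opposite cancels the odd powers of w, and the difference of the
    two pairs cancels A^k. What remains of order two is 2 w^2 ([hpow 2] at E + F minus [hpow 2] at E
    - F), where the difference is twice [d2pow]. *)
Lemma pow_sym4 A E F k :
  bounded_by (fun w : K => `|w| <= 1) (fun w => `|w| ^+ 4)
  (fun w => (A + w *: (E + F)) ^+ k + (A - w *: (E + F)) ^+ k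
     - (A + w *: (E - F)) ^+ k - (A - w *: (E - F)) ^+ k
     - (4 * w ^+ 2) *: d2pow k A E F).
Proof.
have b1 := bounded_byD (pow_rem3 A (E + F) k) (pow_rem3 A (- (E + F)) k).
have b2 := bounded_byD (pow_rem3 A (E - F) k) (pow_rem3 A (- (E - F)) k).
apply: eq_bounded_by (bounded_byD b1 (bounded_byZ (-1) b2)) => // w _ /=.
have e1 := hpow2D k A E F 1; have e2 := hpow2D k A E F (-1).
rewrite !scaleN1r in e2; rewrite !scale1r in e1.
rewrite !hpowN !scalerN e1 e2.
mx_abelian.
Qed.

End Estimates.

(** * Hermite interpolation *)

Section PolynomialMultiplicity.
Variable K : numFieldType.
Implicit Types p q : {poly K}.

Lemma derivn_root_dvdp p z m :
  (forall j, (j < m)%N -> (derivn j p).[z] = 0) <-> ('X - z%:P) ^+ m %| p.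
Proof.
split=> [pz | ].
  elim: m pz => [|m IHm] pz; first by rewrite expr0 dvd1p.
  have /dvdpP[q pE] := IHm (fun j ltjm => pz j (ltnW ltjm)).
  suff: root q z.
    by rewrite exprS -dvdp_XsubCl => /(dvdp_mul) /(_ (dvdpp (('X - z%:P) ^+ m))); rewrite -pE.
  have := pz m (leqnn _); rewrite pE.
  (* At z only the term where all m derivations hit the power survives; m! is nonzero in
     characteristic zero. *)
  have -> : forall r, (derivn m (r * ('X - z%:P) ^+ m)).[z] = r.[z] *+ m`!.
    elim: m {IHm pz pE} => [|m IHm] r; first by rewrite expr0 mulr1.
    rewrite derivSn derivM deriv_exp derivXsubC mul1r /=.
    rewrite (_ : _ + _ = (r^`() * ('X - z%:P) + r *+ m.+1) * ('X - z%:P) ^+ m).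
      by rewrite IHm hornerD hornerMn !hornerE subrr mulr0 add0r factS mulrnA.
    by rewrite mulrDl -mulrA -exprS mulrnAl mulrnAr.
  by move/eqP; rewrite mulrn_eq0 -leqn0 leqNgt fact_gt0.
move=> dvd_p j ltjm.
(* Each derivation lowers the exponent of the known factor by at most one. *)
suff: ('X - z%:P) ^+ (m - j) %| derivn j p.
  move=> dvd_j; apply/eqP; rewrite -[_ == 0]/(root _ _) -dvdp_XsubCl.
  by apply: dvdp_trans dvd_j; rewrite -[X in X %| _]expr1 dvdp_exp2l ?subn_gt0.
elim: j {ltjm} => [|j IHj]; first by rewrite subn0.
rewrite derivnS subnS; case: (m - j)%N IHj => [_|k].
  by rewrite dvd1p.
move=> /dvdpP[q ->]; rewrite derivM deriv_exp dvdp_add //.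
  by rewrite dvdp_mull // dvdp_exp2l.
by rewrite derivXsubC mul1r /= dvdp_mull // -mulr_natr dvdp_mulr.
Qed.

Lemma eq_derivn_dvdp p q z m :
  (forall j, (j < m)%N -> (derivn j p).[z] = (derivn j q).[z]) <->
  ('X - z%:P) ^+ m %| p - q.
Proof.
rewrite -derivn_root_dvdp; split=> eq_pq j ltjm.
  by rewrite derivnB hornerD hornerN eq_pq // subrr.
by apply/eqP; rewrite -subr_eq0 -hornerN -hornerD -derivnB eq_pq.
Qed.

Lemma prod_XsubC_dvdp (s : seq K) p :
  (forall z, ('X - z%:P) ^+ count_mem z s %| p) ->
  \prod_(z <- s) ('X - z%:P) %| p.
Proof.
have [->|p0] := eqVneq p 0; first by rewrite dvdp0.
elim: s p p0 => [|a s IHs] p p0 sp; first by rewrite big_nil dvd1p.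
have /dvdpP[q pE] : 'X - a%:P %| p.
  apply: dvdp_trans (sp a); rewrite /= eqxx add1n exprS dvdp_mulIl //.
have q0 : q != 0 by apply: contraNneq p0 => q0; rewrite pE q0 mul0r.
rewrite big_cons pE mulrC dvdp_mul2r ?polyXsubC_eq0 //; apply: IHs => // z.
have := sp z; rewrite -!mup_geq // pE mupM ?polyXsubC_eq0 //.
by rewrite -['X - a%:P]expr1 mup_XsubCX /= addnC leq_add2r.
Qed.

End PolynomialMultiplicity.

(** * Matrix functions through interpolating polynomials *)

Section HermiteMatching.
Variable R : realType.
Local Notation C := R[i].
Implicit Types (f : C -> C) (p q : {poly C}) (s : seq C).

(** The nodes form a list whose repetitions encode the multiplicities, so that lists of eigenvalues
    can simply be concatenated. *)
Definition matches f s p := forall z j, (j < count_mem z s)%N ->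
  (derivn j p).[z] = derive1n j f z.

Lemma horner_mx_eq0_dvdp n (B : 'M[C]_n.+1) (p q : {poly C}) :
  horner_mx B p = 0 -> p %| q -> horner_mx B q = 0.
Proof. by move=> p0 /dvdpP[r ->]; rewrite rmorphM /= p0 mulr0. Qed.

(** The minimal polynomial divides the node polynomial, so p and the interpolant chosen in [mxfun]
    agree at each of its roots to the order of that root. Their difference is then a multiple of the
    minimal polynomial and vanishes at B. *)
Lemma mxfun_matches f s p n (B : 'M[C]_n.+1) : matches f s p ->
  horner_mx B (\prod_(z <- s) ('X - z%:P)) = 0 -> mxfun f B = horner_mx B p.
Proof.
move=> fsp sB.
have dvd_ms := mxminpoly_min sB.
have m0 : mxminpoly B != 0 by rewrite monic_neq0 ?mxminpoly_monic.
have s0 : \prod_(z <- s) ('X - z%:P) != 0 :> {poly C}.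
  by rewrite monic_neq0 ?monic_prod_XsubC.
have le_mup z : (mup z (mxminpoly B) <= count_mem z s)%N.
  rewrite -mu_prod_XsubC mup_geq //; apply: dvdp_trans dvd_ms.
  by rewrite -mup_geq.
have mx_div z : ('X - z%:P) ^+ mup z (mxminpoly B) %| mxminpoly B.
  by rewrite -mup_geq.
(* Reducing p modulo the minimal polynomial gives an interpolant of the required degree, which rules
   out the default value of [xget]. *)
have interp : hermite_interpolant f B (p %% mxminpoly B).
  split; first exact: size_mod_mxminpoly.
  move=> z j ltj; rewrite -fsp ?(leq_trans ltj) //.
  move: j ltj; apply/eq_derivn_dvdp; rewrite -dvdpNr opprB.
  rewrite {1}(divp_eq p (mxminpoly B)) addrK.
  by rewrite (dvdp_trans (mx_div z)) // dvdp_mulIr.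
rewrite /mxfun; case: xgetP => [q _ [_ fq]|/(_ (p %% mxminpoly B))/= /(_ interp) //].
apply/eqP; rewrite -subr_eq0 -rmorphB /= -dvd_mxminpoly.
have [r mE] := closed_field_poly_normal (mxminpoly B).
rewrite (eqP (mxminpoly_monic B)) scale1r in mE.
rewrite mE; apply: prod_XsubC_dvdp => z.
apply/eq_derivn_dvdp => j; rewrite -mu_prod_XsubC -mE => ltj.
by rewrite fq // fsp // (leq_trans ltj).
Qed.

End HermiteMatching.

(** * Complex power series *)

Section ComplexModulus.
Variable R : realType.
Local Notation C := R[i].
Local Notation normc := (@Normc.normc R).
Local Notation Re := (@complex.Re R).
Local Notation Im := (@complex.Im R).
Implicit Types z w : C.

(** The norm of R[i] takes its values in R[i]; [normc] is the same modulus as an element of R, where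
    real order and linear arithmetic apply. *)
Lemma normr_normc z : `|z| = (normc z)%:C%C.
Proof. by []. Qed.

Lemma normc_ge0 z : 0 <= normc z.
Proof. by rewrite -ler0c -normr_normc. Qed.

Lemma normcX z k : normc (z ^+ k) = normc z ^+ k.
Proof.
by elim: k => [|k IHk]; rewrite ?expr0 ?Normc.normc1 // !exprS Normc.normcM IHk.
Qed.

Lemma normc_real (x : R) : 0 <= x -> normc x%:C%C = x.
Proof. by move=> x0; rewrite /= expr0n addr0 sqrtr_sqr ger0_norm. Qed.

Lemma normc_eq0 z : (normc z == 0) = (z == 0).
Proof. by apply/eqP/eqP => [/Normc.eq0_normc //|->]; rewrite Normc.normc0. Qed.

Lemma normc_gt0 z : (0 < normc z) = (z != 0).
Proof. by rewrite lt_def normc_ge0 andbT normc_eq0. Qed.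

Lemma le_normcB z w : normc (z - w) <= normc z + normc w.
Proof. by rewrite -[normc w]normcN; apply: le_normcD. Qed.

Lemma normcC z w : normc (z - w) = normc (w - z).
Proof. by rewrite -normcN opprB. Qed.

Lemma normc_sum I (r : seq I) (F : I -> C) :
  normc (\sum_(i <- r) F i) <= \sum_(i <- r) normc (F i).
Proof.
elim/big_rec2: _ => [|i x y _ le_xy]; first by rewrite Normc.normc0.
by apply: le_trans (le_normcD _ _) _; rewrite lerD2l.
Qed.

Lemma Re_le_normc z : `|Re z| <= normc z.
Proof. by rewrite -lecR -normr_normc normc_ge_Re. Qed.

Lemma Im_le_normc z : `|Im z| <= normc z.
Proof.
case: z => a b /=; rewrite -sqrtr_sqr ler_wsqrtr // lerDr sqr_ge0 //.
Qed.

Lemma normc_le_ReIm z : normc z <= `|Re z| + `|Im z|.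
Proof.
case: z => a b /=; rewrite -(@ler_pXn2r _ 2) ?nnegrE ?sqrtr_ge0 ?addr_ge0 //.
rewrite sqr_sqrtr ?addr_ge0 ?sqr_ge0 //.
rewrite sqrrD -!normrX !(ger0_norm (sqr_ge0 _)).
by rewrite lerD2r lerDl mulrn_wge0 // mulr_ge0.
Qed.

Lemma pos_complexE (e : C) : 0 < e -> exists2 d : R, 0 < d & e = d%:C%C.
Proof.
case: e => a b; rewrite ltcE /= => /andP[/eqP -> a0]; exists a => //.
Qed.

Lemma cvgC_normcP T (F : set_system T) {FF : Filter F} (f : T -> C) (l : C) :
  f @ F --> l <-> forall e : R, 0 < e -> \forall t \near F, normc (l - f t) < e.
Proof.
split=> [/cvgrPdist_lt fl e e0 | fl].
  have e0C : 0 < e%:C%C :> C by rewrite ltcR.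
  have := fl _ e0C; apply: filter_app; apply: nearW => t.
  by rewrite normr_normc ltcR.
apply/cvgrPdist_lt => _ /pos_complexE[e e0 ->].
have := fl _ e0; apply: filter_app; apply: nearW => t.
by rewrite normr_normc ltcR.
Qed.

Lemma nearC_normcP (z : C) (P : C -> Prop) :
  (\forall w \near z, P w) <->
  exists2 e : R, 0 < e & forall w, normc (w - z) < e -> P w.
Proof.
split=> [/nbhs_normP[_ /= /pos_complexE[e e0 ->] eP]|[e e0 eP]].
  by exists e => // w we; apply: eP; rewrite /= normr_normc ltcR normcC.
apply/nbhs_normP; exists e%:C%C => /=; first by rewrite ltcR.
by move=> w /=; rewrite normr_normc ltcR normcC; apply: eP.
Qed.

Lemma normc_lim_le (u : nat -> C) (l : C) (B : R) :
  u @ \oo --> l -> (forall k, normc (u k) <= B) -> normc l <= B.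
Proof.
move=> /cvgC_normcP ul uB; rewrite leNgt; apply/negP => Bl.
have e0 : 0 < normc l - B by rewrite subr_gt0.
have [N _ /(_ N (leqnn N)) /=] := ul _ e0.
have := le_normcD (l - u N) (u N); rewrite subrK => h1 h2.
by have := uB N; lra.
Qed.

Lemma cvgC_add_mul (u v : nat -> C) (c l m : C) :
  u @ \oo --> l -> v @ \oo --> m -> (fun k => u k + c * v k) @ \oo --> l + c * m.
Proof.
move=> /cvgC_normcP ul /cvgC_normcP vm; apply/cvgC_normcP => e e0.
have c0 : 0 < normc c + 1 by rewrite ltr_wpDl ?normc_ge0.
have e1 : 0 < e / 2 / (normc c + 1) by rewrite !divr_gt0.
have e2 : 0 < e / 2 by rewrite divr_gt0.
move: (ul _ e2) (vm _ e1); apply: filterS2 => k uk vk.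
rewrite (_ : _ - _ = (l - u k) + c * (m - v k)); last by ring.
apply: le_lt_trans (le_normcD _ _) _; rewrite [e]splitr ltr_leD //.
rewrite Normc.normcM -[leRHS](divfK (lt0r_neq0 c0)) mulrC.
by rewrite ler_pM ?normc_ge0 ?(ltW vk) // lerDl.
Qed.

(** The real and imaginary parts are dominated by a real geometric series, hence converge
    absolutely, and their limits are reassembled. *)
Lemma cvgC_series_geometric (u : nat -> C) (M q : R) : 0 <= q < 1 ->
  (forall k, normc (u k) <= M * q ^+ k) -> cvgn (series u).
Proof.
move=> /andP[q0 q1] uM.
have cv (g : C -> R) : (forall z, `|g z| <= normc z) -> cvgn (series (g \o u)).
  move=> gle; apply: normed_cvg => /=.
  apply: (@series_le_cvg _ _ (geometric M q)) => [k|k|k|] //=.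
  - exact: le_trans (normr_ge0 _) (le_trans (gle _) (uM k)).
  - exact: le_trans (gle _) (uM k).
  - by apply: is_cvg_geometric_series; rewrite ger0_norm.
have /cvg_ex[x /cvgrPdist_lt ux] := cv (Re) Re_le_normc.
have /cvg_ex[y /cvgrPdist_lt uy] := cv (Im) Im_le_normc.
apply/cvg_ex; exists (x +i* y)%C; apply/cvgC_normcP => e e0.
have e20 : 0 < e / 2 by rewrite divr_gt0.
move: (ux _ e20) (uy _ e20); apply: filterS2 => k xk yk.
apply: le_lt_trans (normc_le_ReIm _) _.
have ReIm : (Re (series u k) = series (Re \o u) k) *
            (Im (series u k) = series (Im \o u) k).
  by split; rewrite /series /=; apply: big_morph => // -[? ?] [? ?].
have -> : Re ((x +i* y)%C - series u k) = x - series (Re \o u) k.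
  by rewrite -ReIm; case: (series u k).
have -> : Im ((x +i* y)%C - series u k) = y - series (Im \o u) k.
  by rewrite -ReIm; case: (series u k).
by rewrite [e]splitr ltrD.
Qed.

Lemma normc_series_geometric (u : nat -> C) (M q : R) : 0 <= q < 1 -> 0 <= M ->
  (forall k, normc (u k) <= M * q ^+ k) -> normc (limn (series u)) <= M / (1 - q).
Proof.
move=> q01 M0 uM; apply: normc_lim_le (cvgC_series_geometric q01 uM) _ => n.
case/andP: q01 => q0 q1.
rewrite /series /= big_mkord; apply: le_trans (normc_sum _ _) _.
apply: (@le_trans _ _ (M * \sum_(i < n) q ^+ i)).
  by rewrite mulr_sumr; apply: ler_sum.
rewrite ler_wpM2l // -[leRHS]mul1r ler_pdivlMr ?subr_gt0 //.
rewrite mulrC -opprB mulNr -subrX1 opprB lerBlDr lerDl exprn_ge0 //.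
Qed.

End ComplexModulus.

(** * Power series under a Cauchy bound *)

Section PowerSeries.
Variable R : realType.
Local Notation C := R[i].
Local Notation normc := (@Normc.normc R).
Implicit Types (z w : C) (a b : nat -> C).

Definition psum_inf a z : C := limn (series (fun k => a k * z ^+ k)).

(** A quantitative form of having radius of convergence at least r; keeping M explicit is what later
    yields uniform constants. *)
Definition cauchy_bound (r M : R) a : Prop := forall k, normc (a k) * r ^+ k <= M.

Variables (r : R).
Hypotheses (r0 : 0 < r).

Lemma cauchy_bound_ge0 M a : cauchy_bound r M a -> 0 <= M.
Proof.
move=> /(_ 0%N); rewrite expr0 mulr1; apply: le_trans; exact: normc_ge0.
Qed.

Lemma cauchy_bound_term M a z k : cauchy_bound r M a ->
  normc (a k * z ^+ k) <= M * (normc z / r) ^+ k.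
Proof.
move=> aM; rewrite Normc.normcM normcX expr_div_n mulrA ler_pdivlMr ?exprn_gt0 //.
by rewrite mulrAC ler_wpM2r ?exprn_ge0 ?normc_ge0.
Qed.

Lemma ratio_lt1 z : normc z < r -> 0 <= normc z / r < 1.
Proof.
by move=> zr; rewrite divr_ge0 ?normc_ge0 ?(ltW r0) //= ltr_pdivrMr ?mul1r.
Qed.

Lemma psum_inf_cvg M a z : cauchy_bound r M a -> normc z < r ->
  cvgn (series (fun k => a k * z ^+ k)).
Proof.
move=> aM zr; apply: (cvgC_series_geometric (ratio_lt1 zr)) => k.
exact: cauchy_bound_term.
Qed.

Lemma psum_inf_bound M a z d : cauchy_bound r M a -> normc z <= d -> d < r ->
  normc (psum_inf a z) <= M * r / (r - d).
Proof.
move=> aM zd dr; have zr := le_lt_trans zd dr.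
have M0 := cauchy_bound_ge0 aM.
apply: le_trans (normc_series_geometric (ratio_lt1 zr) M0 _) _ => [k|].
  exact: cauchy_bound_term.
rewrite -mulrA ler_wpM2l // -[1](divff (lt0r_neq0 r0)) -mulrBl invf_div.
by rewrite ler_pM2l // lef_pV2 ?posrE ?subr_gt0 // lerD2l lerN2.
Qed.

Lemma cauchy_boundS M a : cauchy_bound r M a -> cauchy_bound r (M / r) (a \o succn).
Proof.
by move=> aM k /=; rewrite ler_pdivlMr // -mulrA -exprSr.
Qed.

Lemma psum_infS M a z : cauchy_bound r M a -> normc z < r ->
  psum_inf a z = a 0%N + z * psum_inf (a \o succn) z.
Proof.
move=> aM zr.
have aSM := cauchy_boundS aM.
have cvS : series (fun k => (a \o succn) k * z ^+ k) @ \oo --> psum_inf (a \o succn) z.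
  exact: psum_inf_cvg aSM zr.
have := cvgC_add_mul (c := z) (cvg_cst (a 0%N)) cvS.
rewrite (_ : (fun k : nat => _) =
    (fun n => series (fun k => a k * z ^+ k) n.+1)).
  move=> cvS'; apply: cvg_lim; first exact: norm_hausdorff.
  by rewrite -cvg_shiftS; exact: cvS'.
apply/funext => n; rewrite /series /= !big_mkord big_ord_recl expr0 mulr1.
congr (_ + _); rewrite mulr_sumr; apply: eq_bigr => i _ /=.
by rewrite /bump /= add1n exprS mulrCA.
Qed.

Lemma psum_inf0 M a : cauchy_bound r M a -> psum_inf a 0 = a 0%N.
Proof. by move=> aM; rewrite (psum_infS aM) ?Normc.normc0 // mul0r addr0. Qed.

Lemma psum_infD M M' a b c z : cauchy_bound r M a -> cauchy_bound r M' b ->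
  normc z < r ->
  psum_inf (fun k => a k + c * b k) z = psum_inf a z + c * psum_inf b z.
Proof.
move=> aM bM zr.
have := cvgC_add_mul (c := c) (psum_inf_cvg aM zr) (psum_inf_cvg bM zr).
rewrite (_ : (fun k : nat => _) =
    series (fun k => (a k + c * b k) * z ^+ k)).
  by move=> cv; apply: cvg_lim cv; exact: norm_hausdorff.
apply/funext => n; rewrite /series /= !big_mkord mulr_sumr -big_split /=.
by apply: eq_bigr => i _; rewrite mulrDl mulrA.
Qed.

End PowerSeries.

(** * Difference quotients and derivatives of power series *)

Section PowerSeriesCalculus.
Variable R : realType.
Local Notation C := R[i].
Local Notation normc := (@Normc.normc R).
Implicit Types (z w mu : C) (a b : nat -> C) (r M d : R).

(** Synthetic division by z - mu: the quotient has coefficients b_k = a_(k+1) + mu b_(k+1), solved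
    by b_k = sum over j of a_(k+1+j) mu^j. The quotient keeps the same radius r and only its bound
    grows, so divisions can be iterated. *)
Lemma psum_inf_quotient r M a mu d : 0 < r -> cauchy_bound r M a ->
  normc mu <= d -> d < r ->
  exists b, [/\ cauchy_bound r (M / (r - d)) b,
    forall z, normc z < r ->
      psum_inf a z = psum_inf a mu + (z - mu) * psum_inf b z
    & forall k, a k.+1 = b k - mu * b k.+1].
Proof.
move=> r0 aM mud dr; have mur := le_lt_trans mud dr.
have aMn n : cauchy_bound r (M / r ^+ n) (fun j => a (n + j)%N).
  move=> j; rewrite ler_pdivlMr ?exprn_gt0 // -mulrA -exprD addnC.
  exact: aM.
pose b k := psum_inf (fun j => a (k.+1 + j)%N) mu.
have bE k : b k = a k.+1 + mu * b k.+1.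
  rewrite /b (psum_infS r0 (aMn k.+1) mur) addn0; congr (_ + _ * psum_inf _ _).
  by apply/funext => j; rewrite /= addnS.
have bM : cauchy_bound r (M / (r - d)) b.
  move=> k; have := psum_inf_bound r0 (aMn k.+1) mud dr.
  move=> /(ler_wpM2r (exprn_ge0 k (ltW r0))) /le_trans; apply.
  rewrite exprS le_eqVlt; apply/orP; left; apply/eqP.
  by field; rewrite !lt0r_neq0 ?exprn_gt0 ?subr_gt0.
exists b; split=> [//|z zr|k]; last by rewrite bE addrK.
have bSM := cauchy_boundS r0 bM.
have aSE : a \o succn = (fun k => b k + (- mu) * (b \o succn) k).
  by apply/funext => k /=; rewrite bE mulNr addrK.
rewrite (psum_infS r0 aM zr) (psum_infS r0 aM mur).
have -> : psum_inf (a \o succn) mu = b 0%N.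
  by rewrite /b; congr (psum_inf _ _); apply/funext => j; rewrite add1n.
rewrite aSE (psum_infD r0 _ bM bSM zr).
have := psum_infS r0 bM zr.
move: (psum_inf b z) (psum_inf _ z) => x y ->.
by ring.
Qed.

Definition pderiv a k : C := k.+1%:R * a k.+1.

Lemma normc_nat n : normc n%:R = n%:R.
Proof. by rewrite -(rmorph_nat (real_complex R)) normc_real. Qed.

(** A smaller radius absorbs the factor k + 1, because (k+1) r'^k (r - r') <= r^(k+1). *)
Lemma cauchy_bound_pderiv r r' M a : 0 < r' -> r' < r -> cauchy_bound r M a ->
  cauchy_bound r' (M / (r - r')) (pderiv a).
Proof.
move=> r'0 r'r aM k; rewrite Normc.normcM normc_nat ler_pdivlMr ?subr_gt0 //.
apply: le_trans (aM k.+1).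
rewrite -[X in X <= _]mulrA [X in X * _]mulrC -[X in X <= _]mulrA.
rewrite ler_wpM2l ?normc_ge0 // mulrA.
elim: k => [|k IHk]; first by rewrite expr0 expr1; lra.
have := @lerXn2r _ k.+1 r' r; rewrite !nnegrE.
move=> /(_ (ltW r'0) (ltW (lt_trans r'0 r'r)) (ltW r'r)) h.
have := ler_wpM2l (ltW r'0) IHk.
have := ler_wpM2r (_ : 0 <= r - r') h; rewrite subr_ge0 (ltW r'r) => /(_ isT).
rewrite -[k.+2]addn1 natrD exprD expr1 ![r' ^+ k.+1]exprS.
set x := r' ^+ k; set y := r ^+ k.+1; set m := k.+1%:R.
have -> : r' * (m * x * (r - r')) = m * (r' * x) * (r - r') by ring.
by move=> h1 h2; lra.
Qed.

(** By the recurrence, (k+1) a_(k+1) = b_k + k b_k - mu (k+1) b_(k+1). Summed against mu^k, the last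
    two terms cancel, since the sum of k b_k mu^k is mu times that of (k+1) b_(k+1) mu^k. *)
Lemma psum_inf_pderiv r M Mb a b mu : 0 < r -> normc mu < r ->
  cauchy_bound r M a -> cauchy_bound r Mb b ->
  (forall k, a k.+1 = b k - mu * b k.+1) ->
  psum_inf (pderiv a) mu = psum_inf b mu.
Proof.
move=> r0 mur aM bM aE; pose r' := (normc mu + r) / 2.
have mur' : normc mu < r' by rewrite /r'; lra.
have r'r : r' < r by rewrite /r'; lra.
have r'0 : 0 < r' := le_lt_trans (normc_ge0 mu) mur'.
have weaken M' c : cauchy_bound r M' c -> cauchy_bound r' M' c.
  move=> cM k; apply: le_trans (cM k); rewrite ler_wpM2l ?normc_ge0 //.
  by rewrite lerXn2r ?nnegrE ?(ltW r0) ?(ltW r'0) ?(ltW r'r).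
have DbM := cauchy_bound_pderiv r'0 r'r bM.
pose B k : C := k%:R * b k.
have BM : cauchy_bound r' (Mb / (r - r') * r') B.
  case=> [|k]; last by rewrite exprSr mulrA ler_wpM2r ?(ltW r'0) //; exact: DbM.
  rewrite /B mul0r Normc.normc0 mul0r mulr_ge0 ?(ltW r'0) //.
  by rewrite divr_ge0 ?subr_ge0 ?(ltW r'r) // (cauchy_bound_ge0 bM).
have bM' := weaken _ _ bM.
have DaE : pderiv a = (fun k => (b k + 1 * B k) + (- mu) * pderiv b k).
  by apply/funext => k; rewrite /pderiv aE /B -[k.+1]addn1 natrD; ring.
have bBM : cauchy_bound r' (Mb + Mb / (r - r') * r') (fun k => b k + 1 * B k).
  move=> k; rewrite mul1r; apply: le_trans (lerD (bM' k) (BM k)).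
  by rewrite -mulrDl ler_wpM2r ?exprn_ge0 ?(ltW r'0) ?le_normcD.
rewrite DaE (psum_infD r'0 _ bBM DbM mur') (psum_infD r'0 _ bM' BM mur').
rewrite (psum_infS r'0 BM mur') {1}/B mul0r add0r mul1r.
have -> : B \o succn = pderiv b by [].
by rewrite mulNr addrK.
Qed.

Definition psum_on r f a z0 : Prop :=
  forall z, normc (z - z0) < r -> f z = psum_inf a (z - z0).

(** Two divisions at mu = w - z0 suffice: the difference quotient of f is b(h + mu), and it differs
    from b(mu) by h c(h + mu), where c is bounded near mu. *)
Lemma derive1_psum r M a f z0 w : 0 < r -> cauchy_bound r M a ->
  psum_on r f a z0 -> normc (w - z0) < r ->
  derive1 f w = psum_inf (pderiv a) (w - z0).
Proof.
move=> r0 aM fa wr; set mu := w - z0.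
pose d := (normc mu + r) / 2.
have mud : normc mu < d by rewrite /d /mu; lra.
have dr : d < r by rewrite /d /mu; lra.
have [b [bM ab aE]] := psum_inf_quotient r0 aM (ltW mud) dr.
have [c [cM bc _]] := psum_inf_quotient r0 bM (ltW mud) dr.
rewrite (psum_inf_pderiv r0 wr aM bM aE).
have Mc0 := cauchy_bound_ge0 cM.
set K := M / (r - d) / (r - d) * r / (r - d).
have K0 : 0 <= K by rewrite /K divr_ge0 ?(mulr_ge0 Mc0) ?(ltW r0) ?subr_ge0 ?(ltW dr).
rewrite /derive1; apply: cvg_lim; first exact: norm_hausdorff.
apply/cvgC_normcP => e e0.
have e1 : 0 < e / (K + 1) by rewrite divr_gt0 // ltr_wpDl.
have m0 : 0 < Num.min (e / (K + 1)) (d - normc mu).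
  by rewrite lt_min e1 subr_gt0.
apply/nearC_normcP; exists (Num.min (e / (K + 1)) (d - normc mu)) => // h.
rewrite subr0 lt_min => /andP[he hd] h0.
have hmu : normc (h + mu) <= d by apply: le_trans (le_normcD _ _) _; lra.
have hmur := le_lt_trans hmu dr.
have fhw : f (h + w) = psum_inf a (h + mu).
  by rewrite fa -?addrA.
rewrite fhw (fa w) // -/mu.
rewrite (ab _ hmur) [psum_inf a mu + _]addrC addrK addrK.
rewrite scalerA mulVf // scale1r (bc _ hmur) addrK.
rewrite opprD addrA subrr sub0r normcN Normc.normcM.
apply: (@le_lt_trans _ _ (normc h * K)).
  by rewrite ler_wpM2l ?normc_ge0 // (psum_inf_bound r0 cM hmu dr).
apply: (@le_lt_trans _ _ (normc h * (K + 1))).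
  by rewrite ler_wpM2l ?normc_ge0 // lerDl.
by rewrite -ltr_pdivlMr // ltr_wpDl.
Qed.

End PowerSeriesCalculus.

(** * Uniform interpolation *)

Section LocalInterpolation.
Variable R : realType.
Local Notation C := R[i].
Local Notation normc := (@Normc.normc R).
Implicit Types (z w mu : C) (a b : nat -> C) (r M d : R) (p q : {poly C}).

Lemma iter_pderivE j a k :
  iter j (@pderiv R) a k = ((j + k) ^_ j)%:R * a (j + k)%N.
Proof.
elim: j k => [|j IHj] k; first by rewrite /= mul1r.
rewrite iterS /pderiv IHj mulrA -natrM addSnnS; congr (_%:R * _).
by rewrite ffactnSr addKn mulnC.
Qed.

Lemma derive1n_psum r M a f z0 j : 0 < r -> cauchy_bound r M a ->
  psum_on r f a z0 -> derive1n j f z0 = j`!%:R * a j.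
Proof.
move=> r0 aM fa.
(* Each differentiation costs some radius, so the induction covers every r' < r and passes through
   the midpoint s of r' and r. *)
have derj r' : 0 < r' -> r' < r -> (exists M', cauchy_bound r' M' (iter j (@pderiv R) a))
    /\ psum_on r' (derive1n j f) (iter j (@pderiv R) a) z0.
  elim: j r' => [|j IHj] r' r'0 r'r.
    split; last by move=> z zr'; apply: fa; lra.
    exists M => k; apply: le_trans (aM k); rewrite ler_wpM2l ?normc_ge0 //.
    by rewrite lerXn2r ?nnegrE ?(ltW r0) ?(ltW r'0) ?(ltW r'r).
  pose s := (r' + r) / 2.
  have s0 : 0 < s by rewrite /s; lra.
  have r's : r' < s by rewrite /s; lra.
  have sr : s < r by rewrite /s; lra.
  have [[M' M'a] on_s] := IHj s s0 sr.
  split; first by exists (M' / (s - r')); exact: cauchy_bound_pderiv.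
  by move=> z zr'; apply: (derive1_psum s0 M'a on_s); lra.
have [[M' M'a] on_r] := derj (r / 2) ltac:(lra) ltac:(lra).
rewrite on_r subrr ?Normc.normc0; last by lra.
by rewrite (psum_inf0 _ M'a) ?iter_pderivE ?addn0 ?ffactnn //; lra.
Qed.

Lemma poly_bound q d : 0 <= d ->
  exists2 B, 0 <= B & forall w, normc w <= d -> normc q.[w] <= B.
Proof.
move=> d0; exists (\sum_(i < size q) normc q`_i * d ^+ i).
  by apply: sumr_ge0 => i _; rewrite mulr_ge0 ?normc_ge0 ?exprn_ge0.
move=> w wd; rewrite horner_coef; apply: le_trans (normc_sum _ _) _.
apply: ler_sum => i _; rewrite Normc.normcM normcX ler_wpM2l ?normc_ge0 //.
by rewrite lerXn2r ?nnegrE ?normc_ge0.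
Qed.

Lemma small_le0 (x d L : R) : 0 < d ->
  (forall t, 0 < t -> t < d -> x <= t * L) -> x <= 0.
Proof.
move=> d0 xL; rewrite leNgt; apply/negP => x0.
have L0 : 0 < L.
  have := xL (d / 2) ltac:(lra) ltac:(lra); move=> h.
  by have := lt_le_trans x0 h; rewrite pmulr_rgt0 //; lra.
pose t := Num.min (d / 2) (x / (2 * L)).
have t0 : 0 < t by rewrite lt_min !divr_gt0 // mulr_gt0.
have td : t < d by rewrite gt_min; apply/orP; left; lra.
have := xL t t0 td; apply/negP; rewrite -ltNge.
apply: (@le_lt_trans _ _ (x / (2 * L) * L)).
  by rewrite ler_wpM2r ?(ltW L0) // ge_min lexx orbT.
rewrite invfM -!mulrA mulVf ?lt0r_neq0 // mulr1; lra.
Qed.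

(** Letting w tend to 0 along the positive reals identifies the constant coefficients; removing them
    and dividing by w lowers m by one. *)
Lemma psum_coef_unique r M c q m K rho : 0 < r -> cauchy_bound r M c ->
  0 < rho -> rho < r -> 0 <= K ->
  (forall w, 0 < normc w -> normc w < rho ->
    normc (psum_inf c w - q.[w]) <= K * normc w ^+ m) ->
  forall j, (j < m)%N -> c j = q`_j.
Proof.
move=> r0 cM rho0 rhor K0.
elim: m M c q cM => [|m IHm] M c q cM close j; first by rewrite ltn0.
have cSM := cauchy_boundS r0 cM.
pose q' := drop_poly 1 q.
have qE w : q.[w] = q`_0 + w * q'.[w].
  have {1}-> : q = q' * 'X + (q`_0)%:P.
    apply/polyP => i; rewrite coefD coefMX coefC coef_drop_poly.
    by case: i => [|i]; rewrite ?add0r // addr0 addn1.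
  by rewrite !hornerE addrC mulrC.
have split w : normc w < rho ->
    psum_inf c w - q.[w] = (c 0%N - q`_0) + w * (psum_inf (c \o succn) w - q'.[w]).
  by move=> wrho; rewrite (psum_infS r0 cM) ?(lt_trans wrho) // qE; ring.
have c0E : c 0%N = q`_0.
  apply/eqP; rewrite -subr_eq0 -normc_eq0 eq_le normc_ge0 andbT.
  have [B B0 qB] := poly_bound q' (ltW rho0).
  pose L := K + (M / r * r / (r - rho) + B).
  have mn0 : 0 < Num.min rho 1 by rewrite lt_min rho0 /=.
  apply: (small_le0 (L := L) mn0) => t t0; rewrite lt_min => /andP[trho t1].
  have nt : normc t%:C%C = t by rewrite normc_real ?(ltW t0).
  have ntrho : normc t%:C%C < rho by rewrite nt.
  have -> : c 0%N - q`_0 = (psum_inf c t%:C%C - q.[t%:C%C]) -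
      t%:C%C * (psum_inf (c \o succn) t%:C%C - q'.[t%:C%C]).
    by rewrite (split _ ntrho) addrK.
  apply: le_trans (le_normcB _ _) _; rewrite /L [t * (K + _)]mulrDr; apply: lerD.
    apply: le_trans (close _ _ _) _; rewrite ?nt // mulrC exprS -mulrA.
    by rewrite ler_wpM2l ?(ltW t0) // ler_piMl // exprn_ile1 ?(ltW t0) ?(ltW t1).
  rewrite Normc.normcM nt ler_wpM2l ?(ltW t0) //.
  apply: le_trans (le_normcB _ _) _; apply: lerD; last by rewrite qB ?(ltW ntrho).
  exact: (psum_inf_bound r0 cSM (ltW ntrho) rhor).
case: j => [//|j]; rewrite ltnS => ltjm.
rewrite -[c j.+1]/((c \o succn) j) (IHm _ _ q' cSM) // ?coef_drop_poly ?addn1 //.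
move=> w w0 wrho; rewrite -(ler_pM2l w0) -Normc.normcM mulrCA -exprS.
have := split w wrho; rewrite c0E subrr add0r => <-.
exact: close.
Qed.

Definition analytic_germ r f z0 : Prop :=
  0 < r /\ exists M a, cauchy_bound r M a /\ psum_on r f a z0.

(** Translating p to z0 reduces the claim to uniqueness of coefficients. A bound on the error thus
    replaces the differentiation of an interpolation remainder. *)
Lemma matches_order r f z0 p m K rho : analytic_germ r f z0 -> 0 < rho -> 0 <= K ->
  (forall z, 0 < normc (z - z0) -> normc (z - z0) < rho ->
    normc (f z - p.[z]) <= K * normc (z - z0) ^+ m) ->
  forall j, (j < m)%N -> (derivn j p).[z0] = derive1n j f z0.
Proof.
move=> [r0 [M [a [aM fa]]]] rho0 K0 close j ltjm.
rewrite (derive1n_psum _ r0 aM fa).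
pose q := p \Po ('X + z0%:P).
have derq i : derivn i q = derivn i p \Po ('X + z0%:P).
  elim: i => [|i IHi] //.
  by rewrite !derivnS IHi deriv_comp derivD derivX derivC addr0 mulr1.
have -> : (derivn j p).[z0] = (derivn j q).[0].
  by rewrite derq horner_comp !hornerE.
rewrite horner_coef0 coef_derivn addn0 ffactnn -[LHS]mulr_natl; congr (_ * _).
pose rho' := Num.min (rho / 2) (r / 2).
have rho'0 : 0 < rho' by rewrite lt_min !divr_gt0.
have rho'r : rho' < r by rewrite gt_min; apply/orP; right; lra.
apply/esym/(psum_coef_unique r0 aM rho'0 rho'r K0 _ ltjm) => w w0.
rewrite lt_min => /andP[wrho wr].
have := close (w + z0); rewrite addrK => /(_ w0); rewrite fa ?addrK; last lra.
by rewrite horner_comp !hornerE; apply; lra.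
Qed.

(** Dividing the series at the first node leaves a quotient series to be interpolated at the
    remaining nodes. The bound B is fixed before the series and the nodes, and the remainder is the
    node polynomial times a series e that obeys the same bound. *)
Lemma newton_interpolation r d N z0 : 0 < r -> 0 <= d -> d < r ->
  forall M, exists2 B, 0 <= B & forall a s, cauchy_bound r M a -> size s = N ->
    (forall mu, mu \in s -> normc (mu - z0) <= d) ->
    exists p e, [/\ (size p <= N)%N, forall k, normc p`_k <= B, cauchy_bound r B e
      & forall z, normc (z - z0) < r -> psum_inf a (z - z0) =
          p.[z] + (\prod_(mu <- s) ('X - mu%:P)).[z] * psum_inf e (z - z0)].
Proof.
move=> r0 d0 dr; elim: N => [|N IHN] M.
  exists (Num.max M 0); first by rewrite le_max lexx orbT.
  move=> a s aM /size0nil -> _; exists 0, a; split.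
  - by rewrite size_poly0.
  - by move=> k; rewrite coef0 Normc.normc0 le_max lexx orbT.
  - by move=> k; apply: le_trans (aM k) _; rewrite le_max lexx.
  - by move=> z _; rewrite big_nil !hornerE.
have [B B0 HB] := IHN (M / (r - d)).
pose L := normc z0 + d.
have L0 : 0 <= L by rewrite addr_ge0 ?normc_ge0.
pose A := Num.max (M * r / (r - d)) 0.
have A0 : 0 <= A by rewrite le_max lexx orbT.
(* [A] bounds the value of the series at the new node; multiplying the previous polynomial by X - mu
   contributes B + L B. *)
exists (A + B + L * B); first by rewrite !addr_ge0 ?mulr_ge0.
move=> a [//|mu s] aM [sN] sd.
have mud : normc (mu - z0) <= d by rewrite sd ?mem_head.
have [b [bM ab _]] := psum_inf_quotient r0 aM mud dr.
have [|p [e [sp pB eB bpe]]] := HB b s bM sN.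
  by move=> nu nus; rewrite sd // inE nus orbT.
have muL : normc mu <= L.
  by rewrite -[mu](subrK z0); apply: le_trans (le_normcD _ _) _; rewrite addrC lerD2l.
exists ((psum_inf a (mu - z0))%:P + ('X - mu%:P) * p), e; split.
- apply: leq_trans (size_polyD _ _) _; rewrite geq_max size_polyC.
  rewrite (leq_trans (leq_b1 _)) //=; apply: leq_trans (size_polyMleq _ _) _.
  by rewrite size_XsubC.
- move=> k; rewrite coefD coefC mulrBl coefB coefXM coefCM addrA.
  apply: le_trans (le_normcB _ _) _; apply: lerD; last first.
    by rewrite Normc.normcM ler_pM ?normc_ge0.
  apply: le_trans (le_normcD _ _) _; apply: lerD.
    case: eqP => _; last by rewrite Normc.normc0.
    by apply: le_trans (psum_inf_bound r0 aM mud dr) _; rewrite le_max lexx.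
  by case: eqP => _; rewrite ?Normc.normc0.
- move=> k; apply: le_trans (eB k) _; rewrite -addrA addrCA lerDl.
  by rewrite addr_ge0 ?mulr_ge0.
move=> z zr; rewrite (ab _ zr) (bpe _ zr) big_cons hornerD hornerC !hornerM !hornerXsubC.
by ring.
Qed.

Lemma analytic_on_germ (Omega : set C) f z0 : analytic_on Omega f -> Omega z0 ->
  exists r, analytic_germ r f z0.
Proof.
move=> fO /fO [a /nearC_normcP[e e0 ea]].
pose r := e / 2.
have r0 : 0 < r by rewrite /r; lra.
have nr : normc r%:C%C = r by rewrite normc_real ?(ltW r0).
have := ea (r%:C%C + z0); rewrite addrK nr => /(_ _)/cvgP/cvg_series_cvg_0 term0.
have {term0}/cvgC_normcP term0 := term0 ltac:(rewrite /r; lra).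
have [N _ hN] := term0 _ ltr01.
exists r; split=> //.
(* The terms at the point z0 + r tend to 0, so they are below 1 from N on, and the sum takes care of
   the earlier ones. *)
exists (1 + \sum_(k < N) normc (a k) * r ^+ k), a; split.
  move=> k; have [ltkN|leNk] := ltnP k N.
    rewrite (bigD1 (Ordinal ltkN)) //= addrCA lerDl addr_ge0 //.
    by apply: sumr_ge0 => i _; rewrite mulr_ge0 ?normc_ge0 ?exprn_ge0 ?(ltW r0).
  have := hN k leNk; rewrite /= sub0r normcN Normc.normcM normcX nr => /ltW /le_trans; apply.
  rewrite lerDl; apply: sumr_ge0 => i _.
  by rewrite mulr_ge0 ?normc_ge0 ?exprn_ge0 ?(ltW r0).
move=> z zr; apply/esym/cvg_lim; first exact: norm_hausdorff.
by apply: ea; move: zr; rewrite /r; lra.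
Qed.

Lemma cluster_interpolation (Omega : set C) f z0 : open Omega ->
  analytic_on Omega f -> Omega z0 ->
  exists2 d, 0 < d & forall N, exists2 B, 0 <= B & forall s, size s = N ->
    (forall mu, mu \in s -> normc (mu - z0) < d) ->
    exists p, [/\ (size p <= N)%N, forall k, normc p`_k <= B & matches f s p].
Proof.
move=> oO fO Oz0.
have [r fr] := analytic_on_germ fO Oz0.
have [r0 [M [a [aM fa]]]] := fr.
have /nearC_normcP[e e0 eO] : \forall z \near z0, Omega z by exact: open_nbhs_nbhs.
(* The bound r / 2 keeps the nodes well inside the disc of the series at z0; e / 2 keeps them in
   [Omega], so that f also has a series centred at each node. *)
pose d := Num.min (r / 2) (e / 2).
have d0 : 0 < d by rewrite lt_min !divr_gt0.
have dr : d <= r / 2 by rewrite ge_min lexx.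
have de : d <= e / 2 by rewrite ge_min lexx orbT.
exists d => // N.
have [B B0 HB] := newton_interpolation N z0 r0 (ltW d0) ltac:(lra) M.
exists B => // s sN sd.
have [|p [g [sp pB gB pg]]] := HB a s aM sN; first by move=> mu /sd/ltW.
exists p; split=> // w j ltj; have ws : w \in s.
  by rewrite -has_pred1 has_count (leq_ltn_trans _ ltj).
have wd := sd w ws.
have [r1 fw] := analytic_on_germ fO (eO w ltac:(lra)).
(* Splitting off the full power of X - w from the node polynomial shows the error to be of that
   order at w. On the disc of radius r / 4 about w the other factors are bounded, as it stays within
   3r / 4 of z0. *)
have /dvdpP[h hE] : ('X - w%:P) ^+ count_mem w s %| \prod_(mu <- s) ('X - mu%:P).
  by rewrite -mu_prod_XsubC -mup_geq // monic_neq0 ?monic_prod_XsubC.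
have rho0 : 0 < r / 4 by lra.
have [Bh Bh0 hB] := poly_bound h (addr_ge0 (normc_ge0 z0) (ltW r0)).
pose D := B * r / (r - r / 4 * 3).
have D0 : 0 <= D by rewrite /D divr_ge0 ?mulr_ge0 //; lra.
apply: (matches_order fw rho0 (mulr_ge0 Bh0 D0) _ ltj) => z _ zw.
have zz0 : normc (z - z0) <= r / 4 * 3.
  rewrite -[z](subrK w) -addrA; apply: le_trans (le_normcD _ _) _; lra.
rewrite fa ?pg; try lra.
rewrite addrC addKr hE hornerM horner_exp hornerXsubC.
rewrite -mulrA mulrCA mulrC Normc.normcM normcX ler_wpM2r ?exprn_ge0 ?normc_ge0 //.
rewrite Normc.normcM ler_pM ?normc_ge0 //.
  apply: hB; rewrite -[z](subrK z0); apply: le_trans (le_normcD _ _) _; lra.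
by apply: (psum_inf_bound r0 gB zz0); lra.
Qed.

End LocalInterpolation.

(** * Interpolation at nodes spread over several discs *)

Section UniformInterpolation.
Variable R : realType.
Local Notation C := R[i].
Local Notation normc := (@Normc.normc R).
Implicit Types (z w mu la : C) (M d : R) (p q : {poly C}) (s l : seq C).

Lemma seq_uniform_small (T : eqType) (P : T -> R -> Prop) (l : seq T) :
  (forall x d d', P x d -> 0 < d' -> d' <= d -> P x d') ->
  (forall x, x \in l -> exists2 d, 0 < d & P x d) ->
  exists2 d, 0 < d & forall x, x \in l -> P x d.
Proof.
move=> Pdown; elim: l => [|x l IHl] Pl; first by exists 1.
have [d d0 Px] := Pl x (mem_head _ _).
have [|e e0 Pe] := IHl; first by move=> y yl; apply: Pl; rewrite inE yl orbT.
have de0 : 0 < Num.min d e by rewrite lt_min d0.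
exists (Num.min d e) => // y; rewrite inE => /orP[/eqP ->|/Pe Py].
  by apply: Pdown Px de0 _; rewrite ge_min lexx.
by apply: Pdown Py de0 _; rewrite ge_min lexx orbT.
Qed.

Lemma seq_uniform_bound (T : eqType) (P : T -> R -> Prop) (l : seq T) :
  (forall x M M', P x M -> M <= M' -> P x M') ->
  (forall x, x \in l -> exists2 M, 0 <= M & P x M) ->
  exists2 M, 0 <= M & forall x, x \in l -> P x M.
Proof.
move=> Pup; elim: l => [|x l IHl] Pl; first by exists 0.
have [d d0 Px] := Pl x (mem_head _ _).
have [|e e0 Pe] := IHl; first by move=> y yl; apply: Pl; rewrite inE yl orbT.
exists (d + e); first exact: addr_ge0.
move=> y; rewrite inE => /orP[/eqP ->|/Pe Py].
  by apply: Pup Px _; rewrite lerDl.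
by apply: Pup Py _; rewrite lerDr.
Qed.

Definition interpolable f N M s : Prop :=
  exists p, [/\ (size p <= N)%N, forall k, normc p`_k <= M & matches f s p].

Definition cluster_at f d z N M : Prop :=
  forall s, size s = N -> (forall mu, mu \in s -> normc (mu - z) < d) ->
    interpolable f N M s.

(** Separating the centres by 3d leaves a distance of at least d between nodes that lie within d of
    different centres. *)
Lemma clusters_uniform (Omega : set C) f l : open Omega -> analytic_on Omega f ->
  (forall la, la \in l -> Omega la) ->
  exists2 d, 0 < d &
    (forall la la', la \in l -> la' \in l -> la != la' -> 3 * d <= normc (la - la')) /\
    (forall N, exists2 M, 0 <= M & forall la, la \in l -> cluster_at f d la N M).
Proof.
move=> oO fO lO.
have [d1 d10 sep] : exists2 d, 0 < d & forall la, la \in l ->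
    forall la', la' \in l -> la != la' -> 3 * d <= normc (la - la').
  apply: seq_uniform_small => [la d d' sep _ le_d la' l' ne|la _].
    by have := sep la' l' ne; lra.
  apply: (seq_uniform_small
    (P := fun la' d => la != la' -> 3 * d <= normc (la - la'))) => [la' d d' sep _ le_d ne|la' _].
    by have := sep ne; lra.
  have [->|ne] := eqVneq la la'; first by exists 1.
  exists (normc (la - la') / 3) => [|_]; last lra.
  by rewrite divr_gt0 // normc_gt0 subr_eq0.
have [d2 d20 clus] : exists2 d, 0 < d & forall la, la \in l ->
    forall N, exists2 M, 0 <= M & cluster_at f d la N M.
  apply: seq_uniform_small => [la d d' cl _ le_d N|la /lO Ola].
    have [M M0 HM] := cl N; exists M => // s sN sd; apply: HM => // mu /sd; lra.
  have [d d0 cl] := cluster_interpolation oO fO Ola.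
  by exists d.
have d0 : 0 < Num.min d1 d2 by rewrite lt_min d10.
have le1 : Num.min d1 d2 <= d1 by rewrite ge_min lexx.
have le2 : Num.min d1 d2 <= d2 by rewrite ge_min lexx orbT.
exists (Num.min d1 d2) => //; split=> [la la' ll ll' ne|N].
  by have := sep la ll la' ll' ne; lra.
apply: seq_uniform_bound => [la M M' cl le_M s sN sd|la ll].
  have [p [sp pM fp]] := cl s sN sd; exists p; split=> // k.
  exact: le_trans (pM k) le_M.
have [M M0 cl] := clus la ll N; exists M => // s sN sd; apply: cl => // mu /sd; lra.
Qed.

(** Neville's formula p = ((X - a) p1 - (X - b) p2) / (b - a), with p1 for b :: u and p2 for a :: u.
    Both p - p1 and p - p2 are a linear factor times a multiple of p1 - p2, which vanishes on u;
    comparison with p2 settles the node a, and comparison with p1 all others. *)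
Lemma neville_step f N M L d a b u : 0 < d -> 0 <= M ->
  normc a <= L -> normc b <= L -> d <= normc (b - a) ->
  interpolable f N M (b :: u) -> interpolable f N M (a :: u) ->
  interpolable f N.+1 (2 * (M + L * M) / d) [:: a, b & u].
Proof.
move=> d0 M0 aL bL dba [p1 [sp1 p1M fp1]] [p2 [sp2 p2M fp2]].
have ba0 : b - a != 0 by rewrite -normc_gt0 (lt_le_trans d0).
pose c := (b - a)^-1.
pose p := c *: (('X - a%:P) * p1 - ('X - b%:P) * p2).
have cba : c *: (b%:P - a%:P) = 1 by rewrite -polyCB scale_polyC mulVf.
have pp1 : p - p1 = ('X - b%:P) * (c *: (p1 - p2)).
  rewrite -[p1 in LHS]mul1r -cba -scalerAl -scalerBr -scalerAr; congr (_ *: _); ring.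
have pp2 : p - p2 = ('X - a%:P) * (c *: (p1 - p2)).
  rewrite -[p2 in LHS]mul1r -cba -scalerAl -scalerBr -scalerAr; congr (_ *: _); ring.
have L0 : 0 <= L := le_trans (normc_ge0 a) aL.
have bound (v : C) (q : {poly C}) k : normc v <= L -> (forall i, normc q`_i <= M) ->
    normc (('X - v%:P) * q)`_k <= M + L * M.
  move=> vL qM; rewrite mulrBl coefB coefXM coefCM.
  apply: le_trans (le_normcB _ _) _; apply: lerD.
    by case: eqP => _; rewrite ?Normc.normc0.
  by rewrite Normc.normcM ler_pM ?normc_ge0.
exists p; split.
- apply: leq_trans (size_scale_leq _ _) _; apply: leq_trans (size_polyD _ _) _.
  rewrite size_polyN geq_max; apply/andP; split;
  by apply: leq_trans (size_polyMleq _ _) _; rewrite size_XsubC.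
- move=> k; rewrite coefZ coefB Normc.normcM mulrC Normc.normcV.
  apply: ler_pM; rewrite ?normc_ge0 ?invr_ge0 ?normc_ge0 //.
    rewrite mulr_natl mulr2n; apply: le_trans (le_normcB _ _) _.
    by apply: lerD; apply: bound.
  by rewrite lef_pV2 ?posrE ?(lt_le_trans d0).
have dvd12 z : ('X - z%:P) ^+ count_mem z u %| p1 - p2.
  apply/eq_derivn_dvdp => j ltj; rewrite fp1 ?fp2 //= ?(leq_trans ltj) ?leq_addl //.
have dvdc z : ('X - z%:P) ^+ count_mem z u %| c *: (p1 - p2).
  by rewrite dvdpZr ?invr_eq0.
move=> z j; have [za|za] := eqVneq a z.
  have bz : (b == z) = false by apply/eqP => bz; rewrite bz za subrr eqxx in ba0.
  rewrite /= za eqxx bz add0n => ltj; rewrite -fp2 /= ?za ?eqxx //.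
  move: j ltj; apply/eq_derivn_dvdp.
  by rewrite pp2 za add1n exprS dvdp_mul.
rewrite /= (negPf za) add0n => ltj; rewrite -fp1 //.
move: j ltj; apply/eq_derivn_dvdp; rewrite pp1 exprD dvdp_mul //.
by case: eqP => [->|_]; rewrite ?expr0 ?dvd1p ?expr1.
Qed.

(** Induction on the number of nodes: a list inside one disc is handled by Newton's scheme, any
    other list contains two nodes at distance at least d and is split by Neville's. *)
Lemma uniform_interpolation (Omega : set C) f l : open Omega ->
  analytic_on Omega f -> (forall la, la \in l -> Omega la) ->
  exists2 d, 0 < d & forall N, exists2 M, 0 <= M & forall s, size s = N ->
    (forall mu, mu \in s -> exists2 la, la \in l & normc (mu - la) < d) ->
    interpolable f N M s.
Proof.
move=> oO fO lO; have [d d0 [sep clus]] := clusters_uniform oO fO lO.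
exists d => // N.
pose L := \sum_(la <- l) normc la + d.
elim: N => [|N [M M0 IHN]].
  exists 0 => // s /size0nil -> _; exists 0; split=> //.
    by rewrite size_poly0.
  by move=> k; rewrite coef0 Normc.normc0.
have [B B0 clB] := clus N.+1.
have L0 : 0 <= L.
  by rewrite addr_ge0 ?(ltW d0) //; apply: sumr_ge0 => *; exact: normc_ge0.
have nearL mu la : la \in l -> normc (mu - la) < d -> normc mu <= L.
  move=> ll mud; rewrite -[mu](subrK la) addrC.
  apply: le_trans (le_normcD _ _) _; apply: lerD; last exact: ltW.
  rewrite (big_rem la) //= lerDl; apply: sumr_ge0 => *; exact: normc_ge0.
exists (B + 2 * (M + L * M) / d).
  by rewrite addr_ge0 // divr_ge0 ?(ltW d0) // mulr_ge0 // addr_ge0 // mulr_ge0.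
move=> s sN sl.
have weaken M1 t : interpolable f N.+1 M1 t -> M1 <= B + 2 * (M + L * M) / d ->
    interpolable f N.+1 (B + 2 * (M + L * M) / d) t.
  by move=> [p [sp pM fp]] le1; exists p; split=> // k; apply: le_trans (pM k) le1.
case: s sN sl => [//|a t] [tN] sl.
have [la ll ald] := sl a (mem_head _ _).
(* If some node b is not in the disc of the first node a, then dropping a or b leaves the two
   shorter lists of Neville's step. *)
have [allc|] := boolP (all (fun mu => normc (mu - la) < d) (a :: t)).
  apply: (weaken B); last first.
    by rewrite lerDl divr_ge0 ?(ltW d0) // mulr_ge0 // addr_ge0 // mulr_ge0.
  by apply: (clB la ll) => [|mu /(allP allc)//]; rewrite /= tN.
rewrite -has_predC => /hasP[b bs /= nbd].
have bt : b \in t.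
  by move: bs; rewrite inE => /orP[/eqP ba|//]; rewrite ba ald in nbd.
have perm_t := perm_to_rem bt.
set u := rem b t in perm_t.
have [lb llb bld] := sl b bs.
have lab : lb != la by apply: contraNneq nbd => <-.
have dba : d <= normc (b - a).
  have := sep lb la llb ll lab.
  have -> : lb - la = (b - a) - (b - lb) + (a - la) by ring.
  have := le_normcD ((b - a) - (b - lb)) (a - la).
  have := le_normcB (b - a) (b - lb).
  lra.
have uN : (size u).+1 = N by rewrite -tN (perm_size perm_t).
have i1 : interpolable f N M (b :: u).
  apply: IHN => [|mu mbu]; first by rewrite /= uN.
  by apply: sl; rewrite inE (perm_mem perm_t) mbu orbT.
have i2 : interpolable f N M (a :: u).
  apply: IHN => [|mu]; first by rewrite /= uN.
  rewrite inE => /orP[/eqP ->|mu_u]; apply: sl; rewrite inE ?eqxx //.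
  by rewrite (perm_mem perm_t) inE mu_u !orbT.
have [p [sp pM fp]] := neville_step d0 M0 (nearL _ _ ll ald) (nearL _ _ llb bld) dba i1 i2.
apply: (weaken (2 * (M + L * M) / d)); last by rewrite lerDr.
exists p; split=> // z j ltj; apply: fp; apply: leq_trans ltj _.
have /permP <- : perm_eq (a :: t) [:: a, b & u] by rewrite perm_cons.
exact: leqnn.
Qed.

End UniformInterpolation.

(** * Representation of f by polynomials near A0 *)

Section MatrixInterpolation.
Variable R : realType.
Local Notation C := R[i].
Local Notation normc := (@Normc.normc R).

Lemma horner_mx_eigenvector (K : fieldType) n (B : 'M[K]_n.+1) (v : 'rV_n.+1) mu p :
  v *m B = mu *: v -> v *m horner_mx B p = p.[mu] *: v.
Proof.
move=> vB; elim/poly_ind: p => [|p c IHp]; first by rewrite rmorph0 mulmx0 horner0 scale0r.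
rewrite rmorphD rmorphM /= horner_mx_X horner_mx_C mulmxDr mulmxA IHp -scalemxAl vB.
by rewrite mul_mx_scalar scalerA -scalerDl !hornerE.
Qed.

(** A row eigenvector of B for mu is one of q(B) for q(mu), and a submultiplicative norm bounds
    every eigenvalue. *)
Lemma root_char_poly_bound (K : numFieldType) n (B : 'M[K]_n.+1) q mu :
  root (char_poly B) mu -> `|q.[mu]| <= mnorm (horner_mx B q).
Proof.
rewrite -eigenvalue_root_char => /eigenvalueP[v vB v0].
have [j vj0] : exists j, v 0 j != 0.
  apply/existsP; rewrite -negb_forall; apply: contra v0 => /forallP v0.
  by apply/eqP/rowP => j; rewrite mxE (eqP (v0 j)).
have nv0 : 0 < mnorm v.
  by apply: lt_le_trans (entry_le_mnorm v 0 j); rewrite normr_gt0.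
rewrite -(ler_pM2r nv0) -mnormZ -(horner_mx_eigenvector q vB) mulrC.
exact: mnorm_mulmx.
Qed.

Lemma horner_mx_lipschitz (K : numFieldType) n (A : 'M[K]_n.+1) q :
  exists2 c, 0 <= c & forall B, near1 A B ->
    mnorm (horner_mx B q - horner_mx A q) <= c * mnorm (B - A).
Proof.
have M0 : 0 <= \sum_(i < size q) `|q`_i| by apply: sumr_ge0.
have [c c0 cP] := psum_bounded_by (size q) M0
  (fun B => mnorm_ge0 (B - A)) (pow_rem0 A).
exists c => // B AB; rewrite !horner_mx_psum -psum_sub; apply: cP => // i.
have [lti|lei] := ltnP i (size q); last by rewrite nth_default // normr0.
by rewrite (bigD1 (Ordinal lti)) //= lerDl; apply: sumr_ge0.
Qed.

Definition eigs n (B : 'M[C]_n.+1) : seq C :=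
  sval (closed_field_poly_normal (char_poly B)).

Lemma prod_eigs n (B : 'M[C]_n.+1) :
  \prod_(z <- eigs B) ('X - z%:P) = char_poly B.
Proof.
rewrite /eigs; case: closed_field_poly_normal => r /= rE.
by rewrite [RHS]rE (eqP (char_poly_monic B)) scale1r.
Qed.

Lemma size_eigs n (B : 'M[C]_n.+1) : size (eigs B) = n.+1.
Proof.
by have := size_char_poly B; rewrite -prod_eigs size_prod_XsubC => -[].
Qed.

Lemma mem_eigs n (B : 'M[C]_n.+1) mu : (mu \in eigs B) = eigenvalue B mu.
Proof. by rewrite eigenvalue_root_char -prod_eigs root_prod_XsubC. Qed.

(** The characteristic polynomial of A vanishes at A by Cayley-Hamilton, so it is small at B and
    hence at each eigenvalue mu of B. Its value at mu is a product of n + 1 differences mu - la; if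
    it is below d^(n+1) in modulus, some factor is below d. *)
Lemma eigs_close n (A : 'M[C]_n.+1) (d : R) : 0 < d ->
  exists2 e : R, 0 < e & forall B : 'M[C]_n.+1, mnorm (B - A) < e%:C%C ->
    forall mu, mu \in eigs B -> exists2 la, la \in eigs A & normc (mu - la) < d.
Proof.
move=> d0; have [c c0 cP] := horner_mx_lipschitz A (char_poly A).
have q0 : horner_mx A (char_poly A) = 0 := Cayley_Hamilton A.
have k0 : 0 < d ^+ n.+1 / (normc c + 1).
  by rewrite divr_gt0 ?exprn_gt0 // ltr_wpDl ?normc_ge0.
exists (Num.min 1 (d ^+ n.+1 / (normc c + 1))) => [|B].
  by rewrite lt_min ltr01.
have [r mE] : exists r : R, mnorm (B - A) = r%:C%C.
  by apply/complex_realP/ger0_real/mnorm_ge0.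
rewrite mE ltcR lt_min => /andP[r1 rd] mu muB.
have AB : near1 A B by rewrite /near1 mE lecR ltW.
have rmu : root (char_poly B) mu by rewrite -prod_eigs root_prod_XsubC.
have r0 : 0 <= r by rewrite -ler0c -mE mnorm_ge0.
have := le_trans (root_char_poly_bound (char_poly A) rmu) _.
move=> /(_ (c * mnorm (B - A))); have := cP B AB; rewrite q0 subr0 => h /(_ h).
rewrite mE -[c]ger0_norm // !normr_normc -rmorphM lecR /= => small.
have {small} : normc (char_poly A).[mu] < d ^+ n.+1.
  apply: le_lt_trans small _; apply: (@le_lt_trans _ _ ((normc c + 1) * r)).
    by rewrite ler_wpM2r // lerDl.
  by rewrite mulrC -ltr_pdivlMr // ltr_wpDl ?normc_ge0.
move=> small; have [/hasP[la lA lad]|] := boolP (has (fun la => normc (mu - la) < d) (eigs A)).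
  by exists la.
rewrite -all_predC => /allP far; move: small; rewrite -prod_eigs ltNge => /negP[].
rewrite -(size_eigs A); elim: (eigs A) far => [|la l IHl] far.
  by rewrite big_nil hornerC Normc.normc1 expr0.
rewrite big_cons hornerM hornerXsubC Normc.normcM exprS ler_pM ?exprn_ge0 ?(ltW d0) //.
  by rewrite leNgt; apply: far; rewrite mem_head.
by apply: IHl => x xl; apply: far; rewrite inE xl orbT.
Qed.

(** The radius e serves all m, and M depends only on the number m of matrices. The size k is free,
    so the same p also represents f at larger block matrices. *)
Lemma uniform_representation (Omega : set C) f n (A : 'M[C]_n.+1) :
  open Omega -> analytic_on Omega f -> spectrum_in Omega A ->
  exists2 e : R, 0 < e & forall m, exists2 M : R, 0 <= M &
    forall Bs : seq 'M[C]_n.+1, size Bs = m ->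
      (forall B, B \in Bs -> mnorm (B - A) < e%:C%C) ->
      exists p : {poly C}, [/\ (size p <= m * n.+1)%N,
        forall i, `|p`_i| <= M%:C%C
        & forall k (B : 'M[C]_k.+1),
            horner_mx B (\prod_(B' <- Bs) char_poly B') = 0 ->
            mxfun f B = horner_mx B p].
Proof.
move=> oO fO AO; have lO la : la \in eigs A -> Omega la.
  by rewrite mem_eigs; apply: AO.
have [d d0 interp] := uniform_interpolation oO fO lO.
have [e e0 eP] := eigs_close A d0.
exists e => // m; have [M M0 HM] := interp (m * n.+1)%N.
exists M => // Bs Bsm Bse; pose s := flatten [seq eigs B | B <- Bs].
have sE : \prod_(z <- s) ('X - z%:P) = \prod_(B <- Bs) char_poly B :> {poly C}.
  by rewrite big_flatten big_map; apply: eq_bigr => B _; rewrite prod_eigs.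
have sN : size s = (m * n.+1)%N.
  rewrite -Bsm /s {sE}; elim: (Bs) => [|B Bs' IH] //=.
  by rewrite size_cat size_eigs IH mulSn.
have [|p [sp pM fp]] := HM s sN.
  by move=> mu /flattenP[_ /mapP[B BBs ->] muB]; exact: eP (Bse B BBs) mu muB.
exists p; split=> // [i|k B Bs0]; first by rewrite normr_normc lecR.
by apply: mxfun_matches fp _; rewrite sE.
Qed.

End MatrixInterpolation.

(** * The block matrix X2 *)

Section RotationBlocks.
Variable K : numClosedFieldType.

Lemma horner_mx_intertwine (F : comNzRingType) m n (X : 'M[F]_m.+1) (Y : 'M[F]_n.+1)
    (V : 'M[F]_(m.+1, n.+1)) p :
  X *m V = V *m Y -> horner_mx X p *m V = V *m horner_mx Y p.
Proof.
move=> XV; elim/poly_ind: p => [|p c IHp]; first by rewrite !rmorph0 mul0mx mulmx0.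
rewrite !rmorphD !rmorphM /= !horner_mx_X !horner_mx_C mulmxDl mulmxDr.
by rewrite -!mulmxE -mulmxA XV !mulmxA IHp mul_scalar_mx mul_mx_scalar.
Qed.

Definition rot_block n (P Q : 'M[K]_n.+1) : 'M[K]_(n.+1 + n.+1) :=
  block_mx P Q (- Q) P.

(** Because c^2 = -1, the block column [1; c] intertwines the rotation block with P + c Q.
    Intertwining passes to polynomials, and the two block rows give the two identities. *)
Lemma horner_rot_block n (P Q : 'M[K]_n.+1) p (c : K) : c ^+ 2 = -1 ->
  let H : 'M[K]_(n.+1 + n.+1) := horner_mx (rot_block P Q) p in
  ulsubmx H + c *: ursubmx H = horner_mx (P + c *: Q) p /\
  dlsubmx H + c *: drsubmx H = c *: horner_mx (P + c *: Q) p.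
Proof.
move=> c2 H; pose V : 'M[K]_(n.+1 + n.+1, n.+1) := col_mx 1%:M c%:M.
have XV : rot_block P Q *m V = V *m (P + c *: Q).
  rewrite mul_block_col mul_col_mx !mulmx1 !mul_mx_scalar mul1mx mul_scalar_mx.
  by rewrite scalerDr scalerA -expr2 c2 scaleN1r [- Q + _]addrC.
have HV : H *m V = V *m horner_mx (P + c *: Q) p := horner_mx_intertwine p XV.
move: HV; rewrite -{1}[H]submxK mul_block_col mul_col_mx !mulmx1 !mul_mx_scalar.
by rewrite mul1mx mul_scalar_mx => /eq_col_mx.
Qed.

Lemma sqr_imaginary : ('i : K) ^+ 2 = -1 /\ (- 'i : K) ^+ 2 = -1.
Proof. by rewrite sqrrN sqrCi. Qed.

(** Subtracting the identities for the two square roots of -1 eliminates the diagonal block. *)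
Lemma ursubmx_rot_block n (P Q : 'M[K]_n.+1) p :
  ursubmx (horner_mx (rot_block P Q) p : 'M[K]_(n.+1 + n.+1)) =
  (2 * 'i)^-1 *: (horner_mx (P + 'i *: Q) p - horner_mx (P - 'i *: Q) p).
Proof.
have [i2 ni2] := sqr_imaginary.
have [<- _] := horner_rot_block P Q p i2; have [] := horner_rot_block P Q p ni2.
rewrite /= !scaleNr => <- _; set X := ulsubmx _; set Y := ursubmx _.
have -> : X + 'i *: Y - (X - 'i *: Y) = (2 * 'i) *: Y.
  by mx_abelian.
by rewrite scalerA mulVf ?scale1r // mulf_neq0 ?pnatr_eq0 ?neq0Ci.
Qed.

Lemma horner_rot_block_eq0 n (P Q : 'M[K]_n.+1) p :
  horner_mx (P + 'i *: Q) p = 0 -> horner_mx (P - 'i *: Q) p = 0 ->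
  horner_mx (rot_block P Q) p = 0.
Proof.
have [i2 ni2] := sqr_imaginary => p1 p2.
have [] := horner_rot_block P Q p i2; have [] := horner_rot_block P Q p ni2.
set H : 'M[K]_(n.+1 + n.+1) := horner_mx _ _.
rewrite /= !scaleNr p1 p2 !scaler0 ?oppr0 => e1 e2 e3 e4.
have zero (X Y : 'M[K]_n.+1) : X - 'i *: Y = 0 -> X + 'i *: Y = 0 -> X = 0 /\ Y = 0.
  move=> XmY XpY; have X0 : 2 *: X = 0.
    rewrite (_ : 2 *: X = (X - 'i *: Y) + (X + 'i *: Y)); last by mx_abelian.
    by rewrite XmY XpY addr0.
  have {}X0 : X = 0.
    by move/eqP: X0; rewrite scaler_eq0 pnatr_eq0 => /eqP.
  split=> //; move/eqP: XpY; rewrite X0 add0r scaler_eq0 (negPf (neq0Ci K)).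
  by move/eqP.
have [ul0 ur0] := zero _ _ e1 e3; have [dl0 dr0] := zero _ _ e2 e4.
by rewrite -[H]submxK ul0 ur0 dl0 dr0 block_mx0.
Qed.

End RotationBlocks.

(** * Reduction of X2 to four shifted matrices *)

Section ComplexStepMatrix.
Variables (R : realType) (n : nat).
Local Notation C := R[i].
Variables (A E1 E2 : 'M[C]_n.+1) (h : R).
Let w : C := 'i * h%:C%C.

Lemma X2E : X2 A E1 E2 h =
  rot_block (rot_block A (h%:C%C *: E1)) (block_mx (h%:C%C *: E2) 0 0 (h%:C%C *: E2)
    : 'M[C]_(n.+1 + n.+1)).
Proof.
rewrite /X2 /rot_block; congr block_mx.
by rewrite (opp_block_mx (h%:C%C *: E2)) !oppr0.
Qed.

Lemma rot_block_add (c : C) :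
  rot_block A (h%:C%C *: E1) + c *: (block_mx (h%:C%C *: E2) 0 0 (h%:C%C *: E2)
    : 'M[C]_(n.+1 + n.+1)) =
  rot_block (A + (c * h%:C%C) *: E2) (h%:C%C *: E1).
Proof.
rewrite /rot_block addrC scale_add_block !scaler0 !add0r scalerA.
by rewrite ![_ + A]addrC.
Qed.

Let Apm : seq 'M[C]_n.+1 :=
  [:: A + w *: (E1 + E2); A - w *: (E1 + E2); A + w *: (E1 - E2); A - w *: (E1 - E2)].

(** The two rotations contribute independent signs: equal signs combine into E1 + E2, opposite ones
    into E1 - E2. *)
Let signE :
  (A + w *: E2 + 'i *: (h%:C%C *: E1) = A + w *: (E1 + E2)) *
  (A + w *: E2 - 'i *: (h%:C%C *: E1) = A - w *: (E1 - E2)) *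
  (A + (- w) *: E2 + 'i *: (h%:C%C *: E1) = A + w *: (E1 - E2)) *
  (A + (- w) *: E2 - 'i *: (h%:C%C *: E1) = A - w *: (E1 + E2)).
Proof.
rewrite /w; move: (h%:C%C) => x; move: E1 E2 => F1 F2.
by split; [split; [split|]|]; apply/matrixP => i j; rewrite !mxE;
  move: (A i j) (F1 i j) (F2 i j) => ? ? ?; ring.
Qed.

(** Allows a polynomial that interpolates f at the eigenvalues of the four shifted matrices to
    represent f at X2. *)
Lemma horner_X2_eq0 p : (forall B, B \in Apm -> horner_mx B p = 0) ->
  horner_mx (X2 A E1 E2 h) p = 0.
Proof.
move=> Bp0; rewrite X2E; apply: horner_rot_block_eq0.
  rewrite rot_block_add; apply: horner_rot_block_eq0; rewrite -/w signE;
  by apply: Bp0; rewrite !inE eqxx ?orbT.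
rewrite -scaleNr rot_block_add mulNr; apply: horner_rot_block_eq0; rewrite -/w signE;
by apply: Bp0; rewrite !inE eqxx ?orbT.
Qed.

Lemma block14_horner_X2 p : block14 (horner_mx (X2 A E1 E2 h) p) =
  - 4^-1 *: (horner_mx (A + w *: (E1 + E2)) p + horner_mx (A - w *: (E1 + E2)) p
    - horner_mx (A + w *: (E1 - E2)) p - horner_mx (A - w *: (E1 - E2)) p).
Proof.
rewrite /block14 X2E ursubmx_rot_block -scaleNr !rot_block_add mulNr -/w.
have e1 := ursubmx_rot_block (A + w *: E2) (h%:C%C *: E1) p.
have e2 := ursubmx_rot_block (A + (- w) *: E2) (h%:C%C *: E1) p.
have ur_lin (c : C) (X Y : 'M[C]_(n.+1 + n.+1)) :
    ursubmx (c *: (X - Y)) = c *: (ursubmx X - ursubmx Y).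
  by apply/matrixP => i j; rewrite !mxE.
have [[[s1 s2] s3] s4] := signE; rewrite s1 s2 in e1; rewrite s3 s4 in e2.
apply: etrans (etrans (ur_lin _ _ _)
  (congr2 (fun U V : 'M[C]_n.+1 => (2 * 'i)^-1 *: (U - V)) e1 e2)) _.
rewrite -scalerBr scalerA.
have -> : (2 * 'i)^-1 * (2 * 'i)^-1 = - 4^-1 :> C.
  by rewrite -invfM mulrACA -['i * 'i]expr2 sqrCi -natrM mulrN1 invrN.
congr (_ *: _).
move: (horner_mx (A + w *: (E1 + E2)) p) (horner_mx (A - w *: (E1 + E2)) p).
move: (horner_mx (A + w *: (E1 - E2)) p) (horner_mx (A - w *: (E1 - E2)) p).
by move=> X Y Z T; mx_abelian.
Qed.

End ComplexStepMatrix.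

(** * Differentials *)

Section MatrixDifferentials.
Variable K : numFieldType.

Lemma entry_le_mx_norm m n (X : 'M[K]_(m, n)) i j : `|X i j| <= `|X|.
Proof.
rewrite -[leRHS]/(mx_norm X) mx_normE -[leLHS]nngE num_le.
exact: (le_bigmax _ (fun ij : 'I_m * 'I_n => `|X ij.1 ij.2|%:nng) (i, j)).
Qed.

Lemma mnorm_le_mx_norm m n (X : 'M[K]_(m, n)) : mnorm X <= (m * n)%:R * `|X|.
Proof.
apply: (@le_trans _ _ (\sum_(i < m) \sum_(j < n) `|X|)).
  by apply: ler_sum => i _; apply: ler_sum => j _; exact: entry_le_mx_norm.
by rewrite !sumr_const !card_ord -mulrnA mulr_natl mulnC.
Qed.

Lemma mx_norm_le_mnorm m n (X : 'M[K]_(m, n)) : `|X| <= mnorm X.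
Proof.
have [->|X0] := eqVneq `|X| 0; first exact: mnorm_ge0.
have [[i j] XE] := mx_norm_neq0 X0.
by rewrite [leLHS]XE; apply: entry_le_mnorm.
Qed.

Lemma mnorm_linear_bound m n p q (L : {linear 'M[K]_(m, n) -> 'M[K]_(p, q)}) :
  exists2 c, 0 <= c & forall X, mnorm (L X) <= c * mnorm X.
Proof.
exists (\sum_i \sum_j mnorm (L (delta_mx i j))).
  by apply: sumr_ge0 => i _; apply: sumr_ge0 => j _; apply: mnorm_ge0.
move=> X; rewrite {1}[X]matrix_sum_delta linear_sum.
apply: le_trans (mnorm_sum _ _ _) _; rewrite mulr_suml; apply: ler_sum => i _.
rewrite linear_sum; apply: le_trans (mnorm_sum _ _ _) _.
rewrite mulr_suml; apply: ler_sum => j _.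
by rewrite linearZ /= mnormZ mulrC ler_wpM2l ?mnorm_ge0 ?entry_le_mnorm.
Qed.

Lemma linear_mx_continuous m n p q
  (L : {linear 'M[K]_(m, n) -> 'M[K]_(p, q)}) : continuous L.
Proof.
have [c c0 Lc] := mnorm_linear_bound L.
apply/linear_bounded_continuous/bounded_funP => r.
exists (c * ((m * n)%:R * r)) => X Xr.
apply: le_trans (mx_norm_le_mnorm _) _; apply: le_trans (Lc X) _.
rewrite ler_wpM2l //; apply: le_trans (mnorm_le_mx_norm X) _.
by rewrite ler_wpM2l.
Qed.

(** A quadratic remainder is little-o of the increment and L is continuous, so uniqueness of the
    differential identifies it with L. *)
Lemma differentiable_quadratic m n p q (F : 'M[K]_(m, n) -> 'M[K]_(p, q))
    (L : {linear 'M[K]_(m, n) -> 'M[K]_(p, q)}) A (e c : K) : 0 < e -> 0 <= c ->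
  (forall B, mnorm (B - A) < e ->
    mnorm (F B - F A - L (B - A)) <= c * mnorm (B - A) ^+ 2) ->
  differentiable F A /\ 'd F A = L :> (_ -> _).
Proof.
move=> e0 c0 FL; have Lc := @linear_mx_continuous _ _ _ _ L.
pose N : K := (m * n)%:R; have N0 : 0 <= N by exact: ler0n.
(* N + 1 is a safe divisor even for empty matrices, where N is 0. *)
have N1 : 0 < N + 1 by rewrite ltr_wpDl.
pose V : normedModType K := 'M[K]_(m, n); pose W : normedModType K := 'M[K]_(p, q).
suff FLo : (F : V -> W)
    \o shift A = cst (F A) + (L : V -> W) +o_ (0 : V) (id : V -> V).
  have dE := diff_unique Lc FLo.
  by split=> //; apply/diff_locallyP; rewrite dE.
have cN1 : 0 < c * N ^+ 2 + 1 by rewrite ltr_wpDl // mulr_ge0 ?exprn_ge0.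
apply/eqaddoP => eps eps0; near=> X.
  have Xe : mnorm X < e.
    apply: le_lt_trans (mnorm_le_mx_norm X) _; apply: (@le_lt_trans _ _ ((N + 1) * `|X|)).
      by rewrite ler_wpM2r // lerDl.
    rewrite mulrC -ltr_pdivlMr //; near: X.
    exact: (@pseudometric_normed_Zmodule.nbhs0_lt K V _ (divr_gt0 e0 N1)).
  have := FL (X + A); rewrite addrK => /(_ Xe) FLX.
  rewrite -[leLHS]/(`|F (X + A) - (F A + L X)|) opprD addrA.
  apply: le_trans (mx_norm_le_mnorm _) _; apply: le_trans FLX _.
  apply: (@le_trans _ _ (c * (N * `|X|) ^+ 2)).
    rewrite ler_wpM2l // lerXn2r ?nnegrE ?mnorm_ge0 ?mulr_ge0 //.
    exact: mnorm_le_mx_norm.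
  rewrite exprMn mulrA [`|X| ^+ 2]expr2 mulrA ler_wpM2r //.
  apply: (@le_trans _ _ ((c * N ^+ 2 + 1) * `|X|)); first by rewrite ler_wpM2r // lerDl.
  rewrite mulrC -ler_pdivlMr //; near: X.
  exact: (@pseudometric_normed_Zmodule.nbhs0_le K V _ (divr_gt0 eps0 cN1)).
Unshelve. all: by end_near. Qed.

Lemma near_mnorm m n (A : 'M[K]_(m, n)) (P : 'M[K]_(m, n) -> Prop) e : 0 < e ->
  (forall B, mnorm (B - A) < e -> P B) -> \forall B \near A, P B.
Proof.
move=> e0 eP; have N1 : 0 < (m * n)%:R + 1 :> K by rewrite ltr_wpDl // ler0n.
apply/nbhs_normP; exists (e / ((m * n)%:R + 1)); first exact: divr_gt0.
move=> B; rewrite /= distrC => AB; apply: eP.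
apply: le_lt_trans (mnorm_le_mx_norm _) _.
apply: (@le_lt_trans _ _ (((m * n)%:R + 1) * `|B - A|)).
  by rewrite ler_wpM2r // lerDl.
by rewrite mulrC -ltr_pdivlMr.
Qed.

End MatrixDifferentials.

(** * Fréchet derivatives and the complex step error *)

Section ComplexStep.
Variable R : realType.
Local Notation C := R[i].

(** Repeating a matrix in [Bs] raises the multiplicity of its eigenvalues, which brings block
    triangular matrices built on it within reach. *)
Definition represents (f : C -> C) n (Bs : seq 'M[C]_n.+1) (p : {poly C}) : Prop :=
  forall k (B : 'M[C]_k.+1), horner_mx B (\prod_(B' <- Bs) char_poly B') = 0 ->
    mxfun f B = horner_mx B p.

Section Represents.
Variables (f : C -> C) (n : nat).
Implicit Types (A B E F : 'M[C]_n.+1) (Bs : seq 'M[C]_n.+1) (p : {poly C}).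

Lemma represents_dvdp Bs p k (B : 'M[C]_k.+1) q : represents f Bs p ->
  horner_mx B q = 0 -> q %| \prod_(B' <- Bs) char_poly B' ->
  mxfun f B = horner_mx B p.
Proof. by move=> fp qB dvd_q; apply: fp; apply: horner_mx_eq0_dvdp qB dvd_q. Qed.

Lemma represents_mem Bs p B : represents f Bs p -> B \in Bs ->
  mxfun f B = horner_mx B p.
Proof.
move=> fp BBs; apply: (represents_dvdp fp (Cayley_Hamilton B)).
by rewrite (big_rem B) //= dvdp_mulr.
Qed.

(** The right-hand side does not mention p, so all representing polynomials have the same derivative
    at A. The next lemma does the same for second derivatives with four copies of A, as squaring is
    applied twice. *)
Lemma dpoly_mxfun Bs p A E : represents f Bs p ->
  char_poly A * char_poly A %| \prod_(B' <- Bs) char_poly B' ->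
  dpoly p A E =
  ursubmx (mxfun f (block_mx A E 0 A : 'M[C]_(n.+1 + n.+1)) : 'M[C]_(n.+1 + n.+1)).
Proof.
move=> fp dvdA.
have A0 := horner_block_tri_sqr_eq0 E (Cayley_Hamilton A).
by rewrite (represents_dvdp fp A0 dvdA) horner_block_tri block_mxKur.
Qed.

Lemma d2poly_mxfun Bs p A E F : represents f Bs p ->
  (char_poly A * char_poly A) * (char_poly A * char_poly A)
    %| \prod_(B' <- Bs) char_poly B' ->
  let P : 'M[C]_(n.+1 + n.+1) := block_mx A E 0 A in
  let Q : 'M[C]_(n.+1 + n.+1) := block_mx F 0 0 F in
  d2poly p A E F = ursubmx (ursubmx (mxfun f
    (block_mx P Q 0 P : 'M[C]_((n + n.+1).+1 + (n + n.+1).+1))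
      : 'M[C]_((n + n.+1).+1 + (n + n.+1).+1)) : 'M[C]_(n.+1 + n.+1)).
Proof.
move=> fp dvdA P Q.
have P0 := horner_block_tri_sqr_eq0 E (Cayley_Hamilton A).
have PQ0 := horner_block_tri_sqr_eq0 (Q : 'M[C]_((n + n.+1).+1)) P0.
rewrite (represents_dvdp fp PQ0 dvdA) horner_block_tri block_mxKur.
by rewrite dpoly_block_tri block_mxKur.
Qed.

End Represents.

Lemma psum_second_difference n (p : {poly C}) (G1 G2 G3 G4 H : nat -> 'M[C]_n.+1) c :
  psum p (fun k => G1 k + G2 k - G3 k - G4 k - c *: H k) =
  psum p G1 + psum p G2 - psum p G3 - psum p G4 - c *: psum p H.
Proof.
rewrite /psum scaler_sumr -big_split -!sumrB /=; apply: eq_bigr => i _.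
by rewrite !scalerBr scalerDr !scalerA [c * _]mulrC.
Qed.

Section ComplexStepError.
Variables (n : nat) (A0 E1 E2 : 'M[C]_n.+1) (Omega : set C) (f : C -> C) (e : R).
Hypothesis e0 : 0 < e.
Hypothesis rep : forall m, exists2 M : R, 0 <= M &
  forall Bs : seq 'M[C]_n.+1, size Bs = m ->
    (forall B, B \in Bs -> mnorm (B - A0) < e%:C%C) ->
    exists p : {poly C}, [/\ (size p <= m * n.+1)%N,
      forall i, `|p`_i| <= M%:C%C & represents f Bs p].

(** A fixed p0 supplies the candidate differential, while each B gets its own p for the estimate;
    the two have equal derivatives at A. The claim covers a whole ball because [frechet f B E1] is
    differentiated in B afterwards. *)
Lemma mxfun_differentiable A : mnorm (A - A0) < e%:C%C ->
  differentiable (@mxfun R f n) A /\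
  forall (Bs : seq 'M[C]_n.+1) p E, represents f Bs p ->
    char_poly A * char_poly A %| \prod_(B' <- Bs) char_poly B' ->
    frechet f A E = dpoly p A E.
Proof.
move=> Ae; have [r rE] : exists r : R, mnorm (A - A0) = r%:C%C.
  by apply/complex_realP/ger0_real/mnorm_ge0.
have re : r < e by rewrite rE ltcR in Ae.
(* The term e - r keeps B in the ball about [A0] where representations exist. *)
pose d := Num.min 1 (e - r).
have d0 : (0 : C) < d%:C%C by rewrite ltcR lt_min ltr01 subr_gt0.
have [M2 _ rep2] := rep 2; have [M M0 rep3] := rep 3.
have [|p0 [_ _ fp0]] := rep2 [:: A; A] erefl.
  by move=> B; rewrite !inE orbb => /eqP ->.
have dvdA Bs : char_poly A * char_poly A %| \prod_(B' <- [:: A, A & Bs]) char_poly B'.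
  by rewrite !big_cons mulrA dvdp_mulr.
have M0C : (0 : C) <= M%:C%C by rewrite ler0c.
have [c c0 cP] := psum_bounded_by (3 * n.+1) M0C
  (fun B => exprn_ge0 2 (mnorm_ge0 (B - A))) (pow_rem1 A).
have [|dfA dE] := @differentiable_quadratic _ _ _ _ _ (@mxfun R f n) (dpoly p0 A) A _ c d0 c0.
  move=> B Bd.
  have B1 : near1 A B.
    by apply: le_trans (ltW Bd) _; rewrite lecR ge_min lexx.
  have Be : mnorm (B - A0) < e%:C%C.
    rewrite -[B](subrK A) -addrA; apply: le_lt_trans (mnormD _ _) _.
    rewrite rE -ltrBrDr -rmorphB; apply: lt_le_trans Bd _.
    by rewrite lecR ge_min lexx orbT.
  have [|p [sp pM fp]] := rep3 [:: A; A; B] erefl.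
    by move=> X; rewrite !inE => /or3P[] /eqP ->.
  rewrite (represents_mem fp (_ : B \in _)) ?inE ?eqxx ?orbT //.
  rewrite (represents_mem fp (_ : A \in _)) ?inE ?eqxx ?orbT //.
  rewrite -[X in mnorm (_ - _ - X)]/(dpoly p0 A (B - A)).
  rewrite (dpoly_mxfun _ fp0 (dvdA [::])) -(dpoly_mxfun _ fp (dvdA [:: B])).
  by rewrite !horner_mx_psum /dpoly -!psum_sub; apply: cP.
split=> // Bs p E fp dvdBs; rewrite /frechet dE.
by rewrite (dpoly_mxfun _ fp dvdBs); exact: (dpoly_mxfun _ fp0 (dvdA [::])).
Qed.

Let chi4 Bs : (char_poly A0 * char_poly A0) * (char_poly A0 * char_poly A0)
  %| \prod_(B' <- [:: A0, A0, A0, A0 & Bs]) char_poly B'.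
Proof. by rewrite !big_cons !mulrA dvdp_mulr. Qed.

Let A0e : mnorm (A0 - A0) < e%:C%C.
Proof. by rewrite subrr mnorm0 ltcR. Qed.

(** The same exchange of p0 for p, one order higher: first-order Taylor expansion of [dpoly p] at
    [A0]. *)
Lemma frechet_differentiable :
  differentiable (fun B : 'M[C]_n.+1 => frechet f B E1) A0 /\
  forall Bs p, represents f [:: A0, A0, A0, A0 & Bs] p ->
    frechet2 f A0 E1 E2 = d2poly p A0 E1 E2.
Proof.
have [M4 _ rep4] := rep 4; have [M M0 rep6] := rep 6.
have [|p0 [_ _ fp0]] := rep4 [:: A0; A0; A0; A0] erefl.
  by move=> B; rewrite !inE !orbb => /eqP ->.
have M0C : (0 : C) <= M%:C%C by rewrite ler0c.
have [c c0 cP] := psum_bounded_by (6 * n.+1) M0C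
  (fun B => exprn_ge0 2 (mnorm_ge0 (B - A0))) (dpow_rem1 A0 E1).
pose d := Num.min 1 e.
have d0 : (0 : C) < d%:C%C by rewrite ltcR lt_min ltr01.
have [|dF dE] := @differentiable_quadratic _ _ _ _ _
    (fun B : 'M[C]_n.+1 => frechet f B E1) (d2poly p0 A0 E1) A0 _ c d0 c0.
  move=> B Bd.
  have B1 : near1 A0 B.
    by apply: le_trans (ltW Bd) _; rewrite lecR ge_min lexx.
  have Be : mnorm (B - A0) < e%:C%C.
    by apply: lt_le_trans Bd _; rewrite lecR ge_min lexx orbT.
  (* Four copies of [A0] fix the second derivative there; two copies of B give the first derivative
     at B. *)
  have [|p [sp pM fp]] := rep6 [:: A0; A0; A0; A0; B; B] erefl.
    by move=> X; rewrite !inE => /or4P[/eqP ->|/eqP ->|/eqP ->|/or3P[] /eqP ->].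
  have [_ frB] := mxfun_differentiable Be.
  have [_ frA] := mxfun_differentiable A0e.
  rewrite (frB _ _ _ fp); last first.
    by rewrite !big_cons big_nil mulr1; do 4!apply: dvdp_mull; exact: dvdpp.
  rewrite (frA _ _ _ fp); last by rewrite !big_cons mulrA dvdp_mulr.
  rewrite -[X in mnorm (_ - _ - X)]/(d2poly p0 A0 E1 (B - A0)).
  rewrite (d2poly_mxfun _ _ fp0 (chi4 [::])) -(d2poly_mxfun _ _ fp (chi4 [:: B; B])).
  by rewrite /d2poly /dpoly -!psum_sub; apply: cP.
split=> // Bs p fp; rewrite /frechet2 dE.
by rewrite (d2poly_mxfun _ _ fp (chi4 Bs)); exact: (d2poly_mxfun _ _ fp0 (chi4 [::])).
Qed.

Lemma complex_step_error : exists2 c : C, 0 <= c & exists2 d : R, 0 < d &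
  forall h : R, h != 0 -> `|h| < d ->
    mnorm (frechet2 f A0 E1 E2 -
      (h%:C%C ^+ 2)^-1 *: block14 (mxfun f (X2 A0 E1 E2 h))) <= c * `|h%:C%C ^+ 2|.
Proof.
have [M M0 rep8] := rep 8.
have M0C : (0 : C) <= M%:C%C by rewrite ler0c.
have [c c0 cP] := psum_bounded_by (8 * n.+1) M0C
  (fun w : C => exprn_ge0 4 (normr_ge0 w)) (pow_sym4 A0 E1 E2).
have [t tE] : exists t : R, mnorm (E1 + E2) + mnorm (E1 - E2) = t%:C%C.
  by apply/complex_realP/ger0_real; rewrite addr_ge0 ?mnorm_ge0.
have t0 : 0 <= t by rewrite -ler0c -tE addr_ge0 ?mnorm_ge0.
have t1 : 0 < t + 1 by rewrite ltr_wpDl.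
(* The bound 1 on |h| gives |w| <= 1, and e / (t + 1) keeps all four shifts shorter than e. *)
exists c => //; exists (Num.min 1 (e / (t + 1))) => [|h h0].
  by rewrite lt_min ltr01 divr_gt0.
rewrite lt_min => /andP[h1 he].
pose w : C := 'i * h%:C%C.
have nh : `|h%:C%C : C| = `|h|%:C%C by rewrite normr_normc /= expr0n addr0 sqrtr_sqr.
have nw : `|w| = `|h|%:C%C by rewrite normrM normCi mul1r nh.
have w1 : `|w| <= 1 by rewrite nw -[1]/(1%:C%C) lecR ltW.
have w2 : w ^+ 2 = - h%:C%C ^+ 2 by rewrite exprMn sqrCi mulN1r.
have small (E : 'M[C]_n.+1) : mnorm E <= t%:C%C -> mnorm (w *: E) < e%:C%C.
  move=> Et; rewrite mnormZ nw.
  apply: (@le_lt_trans _ _ (`|h|%:C%C * t%:C%C)); first by rewrite ler_wpM2l ?ler0c.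
  rewrite -rmorphM ltcR /=; apply: (@le_lt_trans _ _ (`|h| * (t + 1))).
    by rewrite ler_wpM2l // lerDl.
  by rewrite -ltr_pdivlMr.
have sp : mnorm (w *: (E1 + E2)) < e%:C%C.
  by apply: small; rewrite -tE lerDl mnorm_ge0.
have sm : mnorm (w *: (E1 - E2)) < e%:C%C.
  by apply: small; rewrite -tE lerDr mnorm_ge0.
pose Apm := [:: A0 + w *: (E1 + E2); A0 - w *: (E1 + E2);
                A0 + w *: (E1 - E2); A0 - w *: (E1 - E2)].
(* One polynomial must serve both sides: four copies of [A0] for the second derivative and the four
   shifted matrices for X2. *)
have [|p [szp pM fp]] := rep8 [:: A0, A0, A0, A0 & Apm] erefl.
  move=> B; rewrite !inE => /or4P[/eqP->|/eqP->|/eqP->|/or3P[/eqP->|/eqP->|/or3P[]/eqP->]];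
  by rewrite ?[A0 + _ - A0]addrAC subrr ?add0r ?mnorm0 ?mnormN ?ltcR.
have [_ frE] := frechet_differentiable; rewrite (frE _ _ fp).
have -> : mxfun f (X2 A0 E1 E2 h) = horner_mx (X2 A0 E1 E2 h) p.
  apply: fp; apply: horner_X2_eq0 => B BA.
  apply: horner_mx_eq0_dvdp (Cayley_Hamilton B) _.
  by rewrite (big_rem B) /= ?dvdp_mulr // !inE; move: BA; rewrite !inE => ->; rewrite !orbT.
rewrite block14_horner_X2 -/w.
have := cP w p w1 szp pM.
rewrite psum_second_difference -/(d2poly p A0 E1 E2).
rewrite -(horner_mx_psum (A0 + w *: (E1 + E2))) -(horner_mx_psum (A0 - w *: (E1 + E2))).
rewrite -(horner_mx_psum (A0 + w *: (E1 - E2))) -(horner_mx_psum (A0 - w *: (E1 - E2))).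
set S := _ + _ - _ - horner_mx (A0 - w *: (E1 - E2)) p; set D := d2poly p A0 E1 E2; rewrite w2 => SD.
clearbody S D.
have hC0 : h%:C%C != 0 :> C by rewrite (inj_eq (@complexI R) h 0).
(* The error is the fourth-order remainder divided by 4 h^2, since w^2 = - h^2. *)
have -> : D - (h%:C%C ^+ 2)^-1 *: (- 4^-1 *: S) =
    (4 * h%:C%C ^+ 2)^-1 *: (S - (4 * - h%:C%C ^+ 2) *: D).
  move: (h%:C%C) hC0 => x x0.
  rewrite scalerBr !scalerA.
  have -> : (4 * x ^+ 2)^-1 * (4 * - x ^+ 2) = -1 by field; rewrite x0.
  have -> : (x ^+ 2)^-1 * - 4^-1 = - (4 * x ^+ 2)^-1 by field; rewrite x0.
  by rewrite scaleN1r scaleNr !opprK addrC.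
rewrite mnormZ; apply: le_trans (ler_wpM2l (normr_ge0 _) SD) _.
rewrite normfV normrM normr_nat !normrX nh nw.
set x : C := `|h|%:C%C.
have x0 : x != 0 by rewrite /x -nh normr_eq0.
have -> : (4 * x ^+ 2)^-1 * (c * x ^+ 4) = 4^-1 * (c * x ^+ 2).
  by field; rewrite x0.
rewrite ler_piMl ?mulr_ge0 ?exprn_ge0 ?ler0c // invf_le1 ?ler1n ?ltr0n //.
Qed.

End ComplexStepError.
End ComplexStep.

Local Open Scope complex_scope.

Theorem mainTheorem7 (R : realType) (n : nat) (A0 E1 E2 : 'M[R[i]]_n.+1)
    (Omega : set R[i]) (f : R[i] -> R[i])
    (Omega_open : open Omega) (spec_A0 : spectrum_in Omega A0)
    (f_analytic : analytic_on Omega f) (f_real : real_for_real Omega f) :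
  [/\ \forall B \near A0, differentiable (@mxfun R f n) B,
      differentiable (fun B : 'M[R[i]]_n.+1 => frechet f B E1) A0
    & (fun _ : R => frechet2 f A0 E1 E2) =
      (fun h : R => (h%:C ^+ 2)^-1 *: block14 (mxfun f (X2 A0 E1 E2 h)))
      +O_ ((0 : R)^') (fun h : R => h%:C ^+ 2)].
Proof.
have [e e0 rep] := uniform_representation Omega_open f_analytic spec_A0.
split.
- apply: (@near_mnorm _ _ _ _ _ e%:C%C) => [|B Be]; first by rewrite ltcR.
  by have [] := mxfun_differentiable rep Be.
- by have [] := frechet_differentiable E1 E2 e0 rep.
have [c c0 [d d0 err]] := complex_step_error E1 E2 e0 rep.
(* The big-O constant has to be positive, while c may be 0. *)
apply/eqaddOP/bigO_exP; exists (c + 1); first by rewrite ltr_wpDl.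
near=> h.
have h0 : h != 0 by near: h; exact: nbhs_dnbhs_neq.
have hd : `|h| < d by near: h; apply: pseudometric_normed_Zmodule.dnbhs0_lt.
apply: le_trans (mx_norm_le_mnorm _) _; apply: le_trans (err h h0 hd) _.
by rewrite ler_wpM2r // lerDl.
Unshelve. all: by end_near. Qed.
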